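(* Let $(\alpha_0,\alpha_1,\alpha_2,\alpha_3)$ be a rotation quadrangle (in the generic sense described in the context), with relative revolute axes $r_{01}, r_{12}, r_{23}, r_{30}$ in the moving space. Then the two transversals $u$ and $v$ of the four relative revolute axes $r_{01}$, $r_{12}$, $r_{23}$, $r_{30}$ are the only lines $\ell$ of the moving space whose homologous images $\alpha_0(\ell),\alpha_1(\ell),\alpha_2(\ell),\alpha_3(\ell)$ form a skew quadrilateral (with proper orientation, as defined in the context) on a hyperboloid of revolution.
   Context: A displacement is a proper (orientation-preserving) Euclidean motion of three-space, viewed as a map $\alpha$ from a moving space to a fixed space, both copies of Euclidean three-space. Indices are taken modulo four. For four displacements $\alpha_0,\alpha_1,\alpha_2,\alpha_3$ the relative displacements of consecutive positions are $\tau_{i,i+1}=\alpha_{i+1}\circ\alpha_i^{-1}$. The quadruple $(\alpha_0,\alpha_1,\alpha_2,\alpha_3)$ is called a rotation quadrangle (or rotation quadrilateral) if each of $\tau_{01},\tau_{12},\tau_{23},\tau_{30}$ is a pure rotation (about some line). The relative revolute axis $r_{i,i+1}$ in the moving space is the line of points $X$ with $\alpha_i(X)=\alpha_{i+1}(X)$; equivalently, $\alpha_i(r_{i,i+1})=\alpha_{i+1}(r_{i,i+1})$ is the axis of $\tau_{i,i+1}$. The homologous images of an oriented line $\ell$ of the moving space are the oriented lines $\ell_i=\alpha_i(\ell)$, $i=0,1,2,3$. Proper orientation: the lines $\ell_0,\ell_1,\ell_2,\ell_3$ form a skew quadrilateral with vertices $L_{i,i+1}=\ell_i\cap\ell_{i+1}$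 (indices modulo four), and when walking around the edges of the skew quadrilateral $(L_{01},L_{12},L_{23},L_{30})$ one follows the orientation of the lines $\ell_i$ only on every second edge (i.e. the walking direction agrees with and opposes the line orientation alternately). The quadrilateral is on a hyperboloid of revolution if the four lines $\ell_0,\dots,\ell_3$ are contained in that hyperboloid. Standing genericity assumptions: Study's kinematic mapping represents a displacement by a unit dual quaternion $x+\epsilon y$ up to nonzero real scalar factor, i.e. by a point $[x_0:\dots:x_3:y_0:\dots:y_3]$ of the Study quadric $\mathcal{S}=\{x_0y_0+x_1y_1+x_2y_2+x_3y_3=0\}$ in real projective space $P^7$ (with $x\neq 0$). Let $A_i\in\mathcal{S}$ be the image of $\alpha_i$. It is assumed throughout that the quadrilateral $A_0A_1A_2A_3$ spans a three-dimensional projective subspace that is not completely contained in $\mathcal{S}$. A transversal of the four axes is a line meeting all four of them. Only generic configurations are considered; in particular the four axes have precisely two transversals, denoted $u$ and $v$, and the homologous images of each of them form a skew quadrilateral.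
   Formalization: Images of u and v are shown to be skew quadrilaterals on a hyperboloid of revolution, but their proper orientation, which can fail, is not claimed; uniqueness is among properly oriented lines. ''Generic'' means outside the zero set of a polynomial not vanishing on all admissible quadrangles. *)

(* Defs.v *)
(* R is an arbitrary model of the real numbers throughout. *)
From HB Require Import structures.
From mathcomp Require Import all_boot all_order all_algebra.
From mathcomp Require Import reals.
From mathcomp Require Import mpoly.

Set Implicit Arguments.
Unset Strict Implicit.
Unset Printing Implicit Defensive.

Import Order.TTheory GRing.Theory Num.Theory.
Local Open Scope ring_scope.

Definition point (R : realType) := 'cV[R]_3.

Definition dotp (R : realType) n (u v : 'cV[R]_n) : R :=
  \sum_(k < n) u k 0 * v k 0.

(* The indices k + 1 and k + 2 are computed in the ring 'I_3 of integers
   modulo three. *)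
Definition crossp (R : realType) (u v : 'cV[R]_3) : 'cV[R]_3 :=
  \col_(k < 3) (u (k + 1) 0 * v (k + 2%:R) 0 - u (k + 2%:R) 0 * v (k + 1) 0).

Record displacement (R : realType) := Displacement {
  rot : 'M[R]_3;
  trans : 'cV[R]_3;
  rot_SO3 : (rot^T *m rot == 1%:M) && (\det rot == 1)
}.

Definition act (R : realType) (a : displacement R) (X : point R) : point R :=
  rot a *m X + trans a.

Lemma rot_orth (R : realType) (a : displacement R) :
  (rot a)^T *m rot a = 1%:M.
Proof. by have /andP[/eqP] := rot_SO3 a. Qed.

Lemma comp_SO3 (R : realType) (b a : displacement R) :
  ((rot b *m rot a)^T *m (rot b *m rot a) == 1%:M) &&
  (\det (rot b *m rot a) == 1).
Proof.
rewrite trmx_mul -mulmxA (mulmxA (rot b)^T) rot_orth mul1mx rot_orth eqxx.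
have /andP[_ /eqP da] := rot_SO3 a; have /andP[_ /eqP db] := rot_SO3 b.
by rewrite det_mulmx da db mulr1 eqxx.
Qed.

Lemma inv_SO3 (R : realType) (a : displacement R) :
  ((rot a)^T^T *m (rot a)^T == 1%:M) && (\det (rot a)^T == 1).
Proof.
have /andP[_ da] := rot_SO3 a.
by rewrite trmxK (mulmx1C (rot_orth a)) eqxx det_tr.
Qed.

Definition disp_comp (R : realType) (b a : displacement R) : displacement R :=
  @Displacement R (rot b *m rot a) (rot b *m trans a + trans b)
    (comp_SO3 b a).

Definition disp_inv (R : realType) (a : displacement R) : displacement R :=
  @Displacement R (rot a)^T (- ((rot a)^T *m trans a)) (inv_SO3 a).

Lemma act_comp (R : realType) (b a : displacement R) (X : point R) :
  act (disp_comp b a) X = act b (act a X).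
Proof. by rewrite /act /= mulmxDr mulmxA addrA. Qed.

Lemma act_inv (R : realType) (a : displacement R) (X : point R) :
  act (disp_inv a) (act a X) = X.
Proof. by rewrite /act /= mulmxDr mulmxA rot_orth mul1mx addrK. Qed.

(* An oriented line; positive multiples of [dir] give the same orientation. *)
Record oline (R : realType) := OLine {
  base : point R;
  dir : 'cV[R]_3;
  dir_neq0 : dir != 0
}.

Definition on_line (R : realType) (l : oline R) (X : point R) : Prop :=
  exists t : R, X = base l + t *: dir l.

(* Equality of the underlying non-oriented lines. *)
Definition same_line (R : realType) (l m : oline R) : Prop :=
  forall X, on_line l X <-> on_line m X.

Lemma rot_dir_neq0 (R : realType) (a : displacement R) (l : oline R) :
  rot a *m dir l != 0.
Proof.
apply/eqP => h; have := dir_neq0 l.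
by rewrite -(mul1mx (dir l)) -(rot_orth a) -mulmxA h mulmx0 eqxx.
Qed.

Definition line_image (R : realType) (a : displacement R) (l : oline R) :
    oline R :=
  @OLine R (act a (base l)) (rot a *m dir l) (rot_dir_neq0 a l).

(* The proper Euclidean motions whose fixed points are exactly the points of
   a line g are the rotations about g through an angle that is not a multiple
   of 2 pi. *)
Definition rotation_about (R : realType) (t : displacement R) (g : oline R) :
    Prop :=
  forall X, act t X = X <-> on_line g X.

(* Throughout, i + 1 and i - 1 are computed in the ring 'I_4 of integers
   modulo four. *)
Definition quadruple (R : realType) := 'I_4 -> displacement R.

Definition relative_displacement (R : realType) (a : quadruple R) (i : 'I_4) :
    displacement R :=
  disp_comp (a (i + 1)) (disp_inv (a i)).

Definition rotation_quadrangle (R : realType) (a : quadruple R) : Prop :=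
  forall i, exists g, rotation_about (relative_displacement a i) g.

(* The points of the axis r_{i,i+1} in the moving space. *)
Definition on_relative_axis (R : realType) (a : quadruple R) (i : 'I_4)
    (X : point R) : Prop :=
  act (a i) X = act (a (i + 1)) X.

Definition homologous_images (R : realType) (a : quadruple R) (l : oline R) :
    'I_4 -> oline R :=
  fun i => line_image (a i) l.

(* A quaternion is the row of its coordinates with respect to 1, i, j, k. *)
Definition quat (R : realType) := 'rV[R]_(1 + 3).

Definition mkquat (R : realType) (s : R) (v : 'cV[R]_3) : quat R :=
  row_mx s%:M v^T.

Definition qre (R : realType) (x : quat R) : R := lsubmx x 0 0.

Definition qim (R : realType) (x : quat R) : 'cV[R]_3 := (rsubmx x)^T.

Definition qmul (R : realType) (x y : quat R) : quat R :=
  mkquat (qre x * qre y - dotp (qim x) (qim y))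
    (qre x *: qim y + qre y *: qim x + crossp (qim x) (qim y)).

Definition qconj (R : realType) (x : quat R) : quat R :=
  mkquat (qre x) (- qim x).

Definition qnorm (R : realType) (x : quat R) : R :=
  \sum_(k < 1 + 3) x 0 k ^+ 2.

(* Homogeneous coordinates [x_0 : ... : x_3 : y_0 : ... : y_3] in P^7. *)
Definition study_coords (R : realType) := 'rV[R]_((1 + 3) + (1 + 3)).

Definition study_form (R : realType) (A : study_coords R) : R :=
  \sum_(k < 1 + 3) lsubmx A 0 k * rsubmx A 0 k.

(* [A] = [x : y] is a Study image of [a].  With eps^2 = 0, the dual
   quaternion x + eps y maps the point X to the point X' such that
   (x + eps y) (1 + eps X) (conj x - eps conj y) = (x conj x) (1 + eps X');
   the coefficient of eps in this equation is written out below. *)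
Definition study_image (R : realType) (a : displacement R)
    (A : study_coords R) : Prop :=
  let x : quat R := lsubmx A in
  let y : quat R := rsubmx A in
  [/\ x != 0, study_form A = 0 &
      forall X : point R,
        qnorm x *: mkquat 0 (act a X) =
        qmul (qmul x (mkquat 0 X)) (qconj x)
          + (qmul y (qconj x) - qmul x (qconj y))].

(* The Study images of the four displacements span a three-dimensional
   projective subspace (rank four), and some point of this subspace does not
   lie on the Study quadric. *)
Definition study_generic (R : realType) (a : quadruple R) : Prop :=
  exists A : 'I_4 -> study_coords R,
    [/\ forall i, study_image (a i) (A i),
        \rank (\matrix_(i < 4) A i) = 4%N &
        exists w : 'rV[R]_4, study_form (w *m \matrix_(i < 4) A i) != 0].

Definition transversal (R : realType) (a : quadruple R) (l : oline R) : Prop :=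
  forall i, exists X, on_line l X /\ on_relative_axis a i X.

Definition the_two_transversals (R : realType) (a : quadruple R)
    (u v : oline R) : Prop :=
  [/\ transversal a u, transversal a v, ~ same_line u v &
      forall l, transversal a l -> same_line l u \/ same_line l v].

(* [L i] is the vertex L_{i,i+1}: the unique common point of the consecutive
   lines [l i] and [l (i + 1)]. *)
Definition vertices (R : realType) (l : 'I_4 -> oline R)
    (L : 'I_4 -> point R) : Prop :=
  forall i X, on_line (l i) X /\ on_line (l (i + 1)) X <-> X = L i.

Definition coplanar (R : realType) (L : 'I_4 -> point R) : Prop :=
  exists (w : 'cV[R]_3) (c : R), w != 0 /\ forall i, dotp w (L i) = c.

Definition skew_quadrilateral (R : realType) (l : 'I_4 -> oline R) : Prop :=
  exists L, vertices l L /\ ~ coplanar L.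

(* The edge on [l i] is walked from [L (i - 1)] to [L i]. *)
Definition follows_orientation (R : realType) (l : 'I_4 -> oline R)
    (L : 'I_4 -> point R) (i : 'I_4) : bool :=
  0 < dotp (L i - L (i - 1)) (dir (l i)).

(* Stronger than [skew_quadrilateral], also for lines on a hyperboloid of
   revolution: the orientations may instead agree with the walk on two
   consecutive edges and oppose it on the other two. *)
Definition properly_oriented_skew_quadrilateral (R : realType)
    (l : 'I_4 -> oline R) : Prop :=
  exists L, [/\ vertices l L, ~ coplanar L &
    forall i, follows_orientation l L (i + 1) = ~~ follows_orientation l L i].

(* The hyperboloid of revolution (of one sheet) with centre [c], axis in the
   direction of the unit vector [n] and semi-axes [p], [p], [q]. *)
Definition on_hyperboloid (R : realType) (c : point R) (n : 'cV[R]_3)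
    (p q : R) (X : point R) : Prop :=
  let h := dotp n (X - c) in
  (dotp (X - c) (X - c) - h ^+ 2) / p ^+ 2 - h ^+ 2 / q ^+ 2 = 1.

Definition on_hyperboloid_of_revolution (R : realType) (l : 'I_4 -> oline R) :
    Prop :=
  exists (c : point R) (n : 'cV[R]_3) (p q : R),
    [/\ dotp n n = 1, 0 < p, 0 < q &
        forall i X, on_line (l i) X -> on_hyperboloid c n p q X].

Definition standing_assumptions (R : realType) (a : quadruple R) : Prop :=
  [/\ rotation_quadrangle a, study_generic a &
      exists u v, [/\ the_two_transversals a u v,
        skew_quadrilateral (homologous_images a u) &
        skew_quadrilateral (homologous_images a v)]].

(* The 48 matrix and translation entries of the four displacements. *)
Definition coordinates (R : realType) (a : quadruple R) :
    'I_(4 * (3 * (3 + 1))) -> R :=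
  fun k => mxvec (\matrix_(i < 4) mxvec (row_mx (rot (a i)) (trans (a i)))) 0 k.

(* [Q] holds for the generic quadruple satisfying [C]: it can only fail on
   the zero set of a polynomial that does not vanish identically on [C]. *)
Definition generically (R : realType) (C Q : quadruple R -> Prop) : Prop :=
  exists f : {mpoly R[4 * (3 * (3 + 1))]},
    (exists a, C a /\ f.@[coordinates a] != 0) /\
    (forall a, C a -> f.@[coordinates a] != 0 -> Q a).

(* Main.v *)
From Pilot Require Import Defs.
From Stdlib Require Import BinPos BinInt QArith_base Qreduction.
From HB Require Import structures.
From mathcomp Require Import all_boot all_order all_algebra.
From mathcomp Require Import reals.
From mathcomp Require Import mpoly ring lra ssrZ.

Import Pilot.Defs.

(** Let a line with base point b and direction d have homologous images that
    form a skew quadrilateral with vertices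
      L_i = alpha_i (b + p_i d) = alpha_(i+1) (b + q_i d).
    The relative rotation rho_i = alpha_i^-1 o alpha_(i+1) of the moving space,
    with axis r_(i,i+1), takes the point with parameter q_i to the point with
    parameter p_i.  The line meets this axis in the preimage of L_i if the
    shift p_i - q_i vanishes; as a rotation does not move points in the
    direction of its axis, the line is orthogonal to the axis otherwise
    ([slides_perp]).  The edge on the image alpha_i of the line has the signed
    length e_i = p_i - q_(i-1), measured by the image of d.

    For a transversal all shifts are zero, so the sum of the e_i is zero.
    As the polygon closes, the four image directions of d satisfy an affine
    dependence with non-zero coefficients e_i: their end points lie in a plane,
    whose normal makes equal angles with the four lines.  It is the direction
    of the axis of a quadric of revolution through the quadrilateral, and
    skewness makes this quadric a hyperboloid of one sheet
    ([quadrilateral_on_hyperboloid]).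

    Conversely, the rulings of a hyperboloid of revolution make equal angles
    with its axis, so projection of the polygon onto the axis gives a relation
    e_0 +- e_1 +- e_2 +- e_3 = 0.  By the proper orientation the signs of the
    e_i alternate, and the strict triangle inequality leaves the three
    relations e_0 + e_1 + e_2 + e_3 = 0, e_0 + e_1 = e_2 + e_3 and
    e_0 + e_3 = e_1 + e_2 ([alternating_closed_polygon]).  If all shifts
    vanish, then the line is a transversal.  Otherwise it is orthogonal to some
    axes, meets the other ones, and satisfies one of these relations.  Three
    axes orthogonal to a common direction have dependent directions.  If
    there are two of them, they fix the direction of the line, the other two
    axes fix the line, and the relation is a polynomial condition
    ([pair_obstruction]).  If there is only one, then the line is described by
    one parameter that has to satisfy two quadratic equations, whose resultant
    must vanish ([foot_resultant], [slide_resultant]).  The exceptional set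
    of the theorem is the zero set of the product of all these polynomials.

    A quadrangle with rational entries satisfies the standing assumptions and
    is not exceptional ([example_standing]); its obstructions are evaluated in
    exact rational arithmetic. *)

Set Implicit Arguments.
Unset Strict Implicit.
Unset Printing Implicit Defensive.

Import Order.TTheory GRing.Theory Num.Theory.
Local Open Scope ring_scope.

(** * Vector algebra in three-space *)

Section Vectors.
Variable R : realType.
Implicit Types (u v w : 'cV[R]_3).

Lemma ord3_cases (P : 'I_3 -> Prop) : P 0 -> P 1 -> P 2%:R -> forall k, P k.
Proof.
move=> P0 P1 P2 [[|[|[|k]]] lt_k] //.
- by rewrite (_ : Ordinal _ = 0) //; apply: val_inj.
- by rewrite (_ : Ordinal _ = 1) //; apply: val_inj.
- by rewrite (_ : Ordinal _ = 2%:R) //; apply: val_inj.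
Qed.

Lemma ord4_cases (P : 'I_4 -> Prop) :
  P 0 -> P 1 -> P 2%:R -> P 3%:R -> forall k, P k.
Proof.
move=> P0 P1 P2 P3 [[|[|[|[|k]]]] lt_k] //.
- by rewrite (_ : Ordinal _ = 0) //; apply: val_inj.
- by rewrite (_ : Ordinal _ = 1) //; apply: val_inj.
- by rewrite (_ : Ordinal _ = 2%:R) //; apply: val_inj.
- by rewrite (_ : Ordinal _ = 3%:R) //; apply: val_inj.
Qed.

Lemma sum3E (V : nmodType) (F : 'I_3 -> V) :
  \sum_(i < 3) F i = F 0 + F 1 + F 2%:R.
Proof.
rewrite !big_ord_recl big_ord0 addr0 addrA.
by congr (_ + F _ + F _); apply: val_inj.
Qed.

Lemma sum4E (V : nmodType) (F : 'I_4 -> V) :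
  \sum_(i < 4) F i = F 0 + F 1 + F 2%:R + F 3%:R.
Proof.
rewrite !big_ord_recl big_ord0 addr0 !addrA.
by congr (_ + F _ + F _ + F _); apply: val_inj.
Qed.

Lemma colP3 u v :
  u 0 0 = v 0 0 -> u 1 0 = v 1 0 -> u 2%:R 0 = v 2%:R 0 -> u = v.
Proof.
by move=> e0 e1 e2; apply/colP; elim/ord3_cases.
Qed.

Lemma dotpE u v :
  dotp u v = u 0 0 * v 0 0 + u 1 0 * v 1 0 + u 2%:R 0 * v 2%:R 0.
Proof. by rewrite /dotp sum3E. Qed.

Lemma crossp_0 u v :
  crossp u v 0 0 = u 1 0 * v 2%:R 0 - u 2%:R 0 * v 1 0.
Proof. by rewrite mxE !add0r. Qed.

Lemma crossp_1 u v :
  crossp u v 1 0 = u 2%:R 0 * v 0 0 - u 0 0 * v 2%:R 0.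
Proof.
rewrite mxE; congr (u _ 0 * v _ 0 - u _ 0 * v _ 0); exact: val_inj.
Qed.

Lemma crossp_2 u v :
  crossp u v 2%:R 0 = u 0 0 * v 1 0 - u 1 0 * v 0 0.
Proof.
rewrite mxE; congr (u _ 0 * v _ 0 - u _ 0 * v _ 0); exact: val_inj.
Qed.

Lemma addvE u v i : (u + v) i 0 = u i 0 + v i 0. Proof. by rewrite mxE. Qed.
Lemma oppvE u i : (- u) i 0 = - u i 0. Proof. by rewrite mxE. Qed.
Lemma scalevE (c : R) u i : (c *: u) i 0 = c * u i 0.
Proof. by rewrite mxE. Qed.
Lemma zerovE i : (0 : 'cV[R]_3) i 0 = 0. Proof. by rewrite mxE. Qed.

Definition vecE := (dotpE, crossp_0, crossp_1, crossp_2,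
  addvE, oppvE, scalevE, zerovE).

End Vectors.

Ltac vec_ring :=
  try apply: colP3; rewrite ?vecE; ring.

Ltac vec_field :=
  try apply: colP3; rewrite ?vecE; field; done.

Section VectorIdentities.
Variable R : realType.
Implicit Types (u v w : 'cV[R]_3).

Lemma dotpC u v : dotp u v = dotp v u.
Proof. vec_ring. Qed.

Lemma dotpDr u v w : dotp u (v + w) = dotp u v + dotp u w.
Proof. vec_ring. Qed.

Lemma dotpBr u v w : dotp u (v - w) = dotp u v - dotp u w.
Proof. vec_ring. Qed.

Lemma dotpNr u v : dotp u (- v) = - dotp u v.
Proof. vec_ring. Qed.

Lemma dotpZr u (c : R) v : dotp u (c *: v) = c * dotp u v.
Proof. vec_ring. Qed.

Lemma dotpZl u (c : R) v : dotp (c *: u) v = c * dotp u v.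
Proof. vec_ring. Qed.

Lemma dotp_ge0 u : 0 <= dotp u u.
Proof. by rewrite dotpE -!expr2 !addr_ge0 ?sqr_ge0. Qed.

Lemma dotp_eq0 u : dotp u u = 0 -> u = 0.
Proof.
rewrite dotpE => h.
by apply: colP3; rewrite zerovE;
  apply/eqP; rewrite -sqrf_eq0 expr2; apply/eqP; nra.
Qed.

Lemma dotp_gt0 u : u != 0 -> 0 < dotp u u.
Proof.
move=> u0; rewrite lt0r dotp_ge0 andbT; apply: contra u0 => /eqP h.
by rewrite (dotp_eq0 h).
Qed.

End VectorIdentities.

(** * Rotors and lines with a shifted point *)

(** The Study coordinates of a rotation up to a common factor: in the dual
    quaternion k + C + eps N, the vector C has the direction of the axis,
    |C| / k is the tangent of half the angle, and (C, N) are the Pluecker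
    coordinates of the axis, N = X x C for each of its points X; in
    particular C . N = 0. *)
Record rotor (R : realType) := Rotor { rk : R; rC : 'cV[R]_3; rN : 'cV[R]_3 }.

Section Rotors.
Variable R : realType.
Implicit Types (x y m n : rotor R) (b d u v : 'cV[R]_3) (s t : R).

(** A displacement given by the rotor x takes X to X' with
    k (X' - X) = C x (X' + X) + 2 N.  This is the equation for the points
    X = b + q d and X' = b + p d of one line, with s = p + q, t = p - q. *)
Definition slides x b d s t : Prop :=
  (rk x * t) *: d = crossp (rC x) (2 *: b + s *: d) + 2 *: rN x.

(** A rotation preserves the component along its axis, so it can move a point
    along a line only if the line is orthogonal to the axis. *)
Lemma slides_perp x b d s t :
  dotp (rC x) (rN x) = 0 -> rk x != 0 -> t != 0 -> slides x b d s t ->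
  dotp (rC x) d = 0.
Proof.
move=> CN k0 t0 /(congr1 (dotp (rC x))); rewrite dotpZr dotpDr dotpZr CN.
rewrite (_ : dotp (rC x) (crossp _ _) = 0); last by vec_ring.
by rewrite mulr0 addr0 => /eqP; rewrite !mulf_eq0 (negPf k0) (negPf t0) => /eqP.
Qed.

(** For t = 0 the point with parameter s / 2 is fixed, hence on the axis. *)
Lemma slides0_axis x b d s :
  slides x b d s 0 -> rN x = crossp (b + (s / 2) *: d) (rC x).
Proof.
move=> h; apply: (scalerI (_ : 2 != 0 :> R)); first by rewrite pnatr_eq0.
have -> : 2 *: rN x = - crossp (rC x) (2 *: b + s *: d).
  by apply/eqP; rewrite -addr_eq0 addrC -h mulr0 scale0r.
vec_field.
Qed.

Lemma slides0_meet x b d s :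
  slides x b d s 0 -> dotp d (rN x) = dotp d (crossp b (rC x)).
Proof. by move/slides0_axis->; vec_ring. Qed.

Lemma slides_dot x b d s t :
  slides x b d s t ->
  rk x * t * dotp d d = 2 * dotp d (crossp (rC x) b + rN x).
Proof.
move/(congr1 (dotp d)); rewrite dotpZr => ->; vec_ring.
Qed.

(** For a line orthogonal to the axis, s / 2 is the parameter of the point
    midway between X and X', the foot of the common perpendicular of the line
    and the axis. *)
Lemma slides_mid x b d s t : dotp (rC x) d = 0 ->
  slides x b d s t ->
  s * dotp (rC x) (rC x) * dotp d d =
  - 2 * (dotp (rC x) (rC x) * dotp b d + dotp (rN x) (crossp (rC x) d)).
Proof.
move=> Cd /(congr1 (fun v => dotp v (crossp (rC x) d))).
rewrite (_ : dotp (_ *: d) _ = 0); last by vec_ring.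
rewrite (_ : dotp (_ + _) _ =
  2 * (dotp (rC x) (rC x) * dotp b d - dotp (rC x) b * dotp (rC x) d)
  + s * (dotp (rC x) (rC x) * dotp d d - dotp (rC x) d ^+ 2)
  + 2 * dotp (rN x) (crossp (rC x) d)); last by vec_ring.
by rewrite Cd => h; lra.
Qed.

(** The resultant of a0 + a1 t + a2 t^2 and b0 + b1 t + b2 t^2; it vanishes for
    polynomials with a common root even if the leading coefficients are 0. *)
Definition resultant2 (a0 a1 a2 b0 b1 b2 : R) : R :=
  (a2 * b0 - a0 * b2) ^+ 2 - (a2 * b1 - a1 * b2) * (a1 * b0 - a0 * b1).

(** The resultant of (u + t u') . (v + t v') and (u + t u') . (w + t w') as
    polynomials in t. *)
Definition pencil_resultant u u' v v' w w' : R :=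
  resultant2 (dotp u v) (dotp u v' + dotp u' v) (dotp u' v')
             (dotp u w) (dotp u w' + dotp u' w) (dotp u' w').

Lemma pencil_resultant_eq0 u u' v v' w w' t :
  dotp (u + t *: u') (v + t *: v') = 0 ->
  dotp (u + t *: u') (w + t *: w') = 0 ->
  pencil_resultant u u' v v' w w' = 0.
Proof.
have ex v1 v1' : dotp (u + t *: u') (v1 + t *: v1') =
  dotp u v1 + t * (dotp u v1' + dotp u' v1) + t ^+ 2 * dotp u' v1'
  by vec_ring.
rewrite !{}ex /pencil_resultant /resultant2 => h1 h2.
have -> : dotp u v = - (t * (dotp u v' + dotp u' v) + t ^+ 2 * dotp u' v').
  by lra.
have -> : dotp u w = - (t * (dotp u w' + dotp u' w) + t ^+ 2 * dotp u' w').
  by lra.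
ring.
Qed.

(** Obstruction to lines that meet the axes of y, z, w and are orthogonal to
    the axis of x, with the foot of the common perpendicular on the axis of z.
    A point Z of the axis of z determines the line: its direction is
    C x Z + N for the rotor x, linear in Z.  The conditions to meet the axes
    of y and w are quadratic in the parameter of Z. *)
Definition foot_resultant x y z (w : rotor R) : R :=
  let P := crossp (rC z) (rN z) in
  let c := dotp (rC z) (rC z) in
  pencil_resultant
    (crossp (rC x) P + c *: rN x) (crossp (rC x) (rC z))
    (c *: rN y - crossp P (rC y)) (- crossp (rC z) (rC y))
    (c *: rN w - crossp P (rC w)) (- crossp (rC z) (rC w)).

(** Every point of the axis differs from the foot C x N / |C|^2 of the origin by
    a multiple of C; the equation is free of denominators. *)
Lemma axis_point x u : rN x = crossp u (rC x) ->
  dotp (rC x) (rC x) *: u =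
  crossp (rC x) (rN x) + dotp (rC x) u *: rC x.
Proof. by move=> ->; vec_ring. Qed.

Lemma foot_resultant_eq0 x y z w b d s s1 s3 t :
  slides x b d s t -> slides y b d s1 0 -> slides z b d s 0 ->
  slides w b d s3 0 ->
  foot_resultant x y z w = 0.
Proof.
move=> hx /slides0_meet hy /slides0_axis hz /slides0_meet hw.
have ax := axis_point hz.
set u := b + _ in ax.
have du : (rk x * t / 2) *: d = crossp (rC x) u + rN x.
  apply: (scalerI (_ : 2 != 0 :> R)); first by rewrite pnatr_eq0.
  rewrite scalerA (_ : 2 * (_ / 2) = rk x * t); last by field.
  rewrite hx /u; vec_field.
pose c := dotp (rC z) (rC z).
have meet a : dotp d (rN a) = dotp d (crossp b (rC a)) ->
    dotp (crossp (rC x) (crossp (rC z) (rN z)) + c *: rN x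
          + dotp (rC z) u *: crossp (rC x) (rC z))
     (c *: rN a - crossp (crossp (rC z) (rN z)) (rC a)
        + dotp (rC z) u *: - crossp (rC z) (rC a)) = 0.
  move=> ha.
  rewrite (_ : _ + dotp (rC z) u *: crossp (rC x) (rC z) =
    (c * (rk x * t / 2)) *: d); last first.
    rewrite -scalerA du scalerDr addrAC; congr (_ + _).
    transitivity (crossp (rC x) (c *: u)); last by vec_ring.
    by rewrite ax; vec_ring.
  rewrite (_ : _ - _ + _ = c *: (rN a - crossp u (rC a))); last first.
    rewrite scalerBr -addrA; congr (_ + _).
    transitivity (- crossp (c *: u) (rC a)); last by vec_ring.
    by rewrite ax; vec_ring.
  rewrite dotpZl dotpZr dotpBr ha /u.
  by rewrite (_ : _ - _ = 0) ?mulr0 //; vec_ring.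
exact: pencil_resultant_eq0 (meet _ hy) (meet _ hw).
Qed.

(** Obstruction to lines orthogonal to the axis of x that meet the axes of y,
    z, w, where x shifts a point by twice the distance of the points Y and W
    on the axes of y and w.  Orthogonality of Y - W to the axis of x is a
    linear relation between the parameters of Y and W, so that both points
    are linear in one parameter.  The length of the shift and the condition
    to meet the axis of z are quadratic in it. *)
Definition slide_resultant x y z (w : rotor R) : R :=
  let c1 := dotp (rC y) (rC y) in
  let c3 := dotp (rC w) (rC w) in
  let g1 := dotp (rC y) (rC x) in
  let g3 := dotp (rC w) (rC x) in
  let P1 := crossp (rC y) (rN y) in
  let P3 := crossp (rC w) (rN w) in
  let W := c3 *: P1 - c1 *: P3 in
  let h := c1 * c3 * g3 in
  let V := g3 *: W - dotp W (rC x) *: rC w in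
  let V' := g3 *: rC y - g1 *: rC w in
  let U := (g3 * c3) *: P1 in
  let U' := g3 *: rC y in
  pencil_resultant V V'
    (rk x *: V + crossp (rC x) U + h *: rN x) (rk x *: V' + crossp (rC x) U')
    (h *: rN z - crossp U (rC z)) (- crossp U' (rC z)).

(** The vectors V + l V' and U + l U' of [slide_resultant], for l = c3 (C . Y)
    with C the axis vector of y, are h (Y - W) and h Y. *)
Lemma slide_resultant_eq0 x y z w b d s s1 s2 s3 t :
  dotp (rC x) d = 0 ->
  slides x b d s t -> slides y b d s1 0 -> slides z b d s2 0 ->
  slides w b d s3 0 -> s1 - s3 + t = 0 ->
  slide_resultant x y z w = 0.
Proof.
move=> Cd /slides_dot hx /slides0_axis hy /slides0_meet hz /slides0_axis hw st.
have ay := axis_point hy; have aw := axis_point hw.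
set u1 := b + _ in ay; set u3 := b + _ in aw.
rewrite /slide_resultant.
set c1 := dotp (rC y) (rC y) in ay *; set c3 := dotp (rC w) (rC w) in aw *.
set g1 := dotp (rC y) (rC x); set g3 := dotp (rC w) (rC x).
set P1 := crossp (rC y) (rN y) in ay *; set P3 := crossp (rC w) (rN w) in aw *.
set W := c3 *: P1 - c1 *: P3.
pose h := c1 * c3 * g3; rewrite -/h.
pose l := c3 * dotp (rC y) u1.
have eU : (g3 * c3) *: P1 + l *: (g3 *: rC y) = h *: u1.
  transitivity ((g3 * c3) *: (c1 *: u1)); first by rewrite ay /l; vec_ring.
  by rewrite scalerA; congr (_ *: _); rewrite /h; ring.
have uud : u1 - u3 = (- t / 2) *: d.
  have -> : t = s3 - s1 by lra.
  rewrite /u1 /u3; vec_field.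
have eW : W + l *: rC y - (c1 * dotp (rC w) u3) *: rC w
    = (c1 * c3) *: (u1 - u3).
  transitivity (c3 *: (c1 *: u1) - c1 *: (c3 *: u3)); last first.
    by rewrite !scalerA (mulrC c3) -scalerBr.
  by rewrite ay aw /W /l; vec_ring.
have eg : c1 * dotp (rC w) u3 * g3 = dotp W (rC x) + l * g1.
  move/(congr1 (dotp (rC x))): eW.
  rewrite uud !dotpZr Cd !mulr0 dotpBr dotpDr !dotpZr => e.
  by rewrite /g3 /g1 !(dotpC _ (rC x)); lra.
have eV : g3 *: W - dotp W (rC x) *: rC w
    + l *: (g3 *: rC y - g1 *: rC w) = (h * (- t / 2)) *: d.
  have -> : (h * (- t / 2)) *: d = g3 *: ((c1 * c3) *: ((- t / 2) *: d)).
    by rewrite !scalerA; congr (_ *: _); rewrite /h; ring.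
  rewrite -uud -eW.
  have -> : dotp W (rC x) = c1 * dotp (rC w) u3 * g3 - l * g1 by lra.
  by vec_ring.
apply: (@pencil_resultant_eq0 _ _ _ _ _ _ l); rewrite eV.
- rewrite (_ : _ + l *: (rk x *: _ + _) = rk x *: ((h * (- t / 2)) *: d)
      + crossp (rC x) (h *: u1) + h *: rN x); last first.
    by rewrite -eV -eU /h; vec_ring.
  transitivity (h ^+ 2 * (- t / 2) * ((- t / 2) * (rk x * dotp d d)
     + dotp d (crossp (rC x) b + rN x))); first by rewrite /u1 /h; vec_ring.
  rewrite (_ : _ * (rk x * _) = - (rk x * t * dotp d d) / 2); last by field.
  by rewrite hx; field.
- rewrite (_ : _ + l *: - _ = h *: rN z - crossp (h *: u1) (rC z)); last first.
    by rewrite -eU /h; vec_ring.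
  transitivity (h ^+ 2 * (- t / 2)
    * (dotp d (rN z) - dotp d (crossp b (rC z)))).
    by rewrite /u1 /h; vec_ring.
  by rewrite hz subrr mulr0.
Qed.

End Rotors.

(** * Lines orthogonal to two axes *)

Section Pairs.
Variable R : realType.
Implicit Types (x y m n : rotor R) (b d u v : 'cV[R]_3) (s t : R).

Definition join_det m n d : R := dotp d (crossp (rC m) (rC n)).

(** The common factor [join_det] clears the denominators: [join_base] divided by
    it is the base point, in the span of the two axis vectors, of the line
    with direction d that meets the axes of m and n. *)
Definition join_base m n d : 'cV[R]_3 :=
  dotp d (rN n) *: rC m - dotp d (rN m) *: rC n.

(** For a rotor x with axis orthogonal to d, the values t and s of [slides] on
    the line of direction d that meets the axes of m and n, up to factors that
    make them polynomials in d; see [scaled_shiftP] and [scaled_midP]. *)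
Definition scaled_shift m n x d : R :=
  dotp d (crossp (rC x) (join_base m n d) + join_det m n d *: rN x).

Definition scaled_mid m n x d : R :=
  - (dotp (rC x) (rC x) * dotp (join_base m n d) d
     + join_det m n d * dotp (rN x) (crossp (rC x) d)).

(** The linear combination of the values s and t of the four rotors with the
    given coefficients, up to a factor.  The coefficients of the s have to add
    up to zero for a value independent of the base point of the line. *)
Definition pair_form m n x y (a_m a_n a_x a_y b_x b_y : R) d : R :=
  let cx := dotp (rC x) (rC x) in
  let cy := dotp (rC y) (rC y) in
  let kx := rk x in
  let ky := rk y in
  (a_m * dotp (rN m) (rC n) - a_n * dotp (rN n) (rC m))
    * (cx * cy * kx * ky * dotp d d)
  + (a_x * scaled_mid m n x d * cy + a_y * scaled_mid m n y d * cx) * (kx * ky)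
  + (b_x * scaled_shift m n x d * ky + b_y * scaled_shift m n y d * kx)
    * (cx * cy).

(** Lines orthogonal to the axes of x and y have the direction of the cross
    product of the two axis vectors. *)
Definition pair_obstruction m n x y a_m a_n a_x a_y b_x b_y : R :=
  pair_form m n x y a_m a_n a_x a_y b_x b_y (crossp (rC x) (rC y)).

Lemma join_baseP m n b d s s' :
  slides m b d s 0 -> slides n b d s' 0 ->
  join_det m n d *: b = join_base m n d + dotp b (crossp (rC m) (rC n)) *: d.
Proof.
move=> /slides0_meet hm /slides0_meet hn.
by rewrite /join_base /join_det hm hn; vec_ring.
Qed.

(** The summand that depends on the base point b is the same here, in
    [mid_meet_r] and, up to a factor, in [scaled_midP]. *)
Lemma mid_meet_l m n b d s : slides m b d s 0 ->
  dotp (rN m) (rC n) = s * join_det m n d / 2 + dotp b (crossp (rC m) (rC n)).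
Proof. by move/slides0_axis->; rewrite /join_det; vec_field. Qed.

Lemma mid_meet_r m n b d s : slides n b d s 0 ->
  - dotp (rN n) (rC m) =
  s * join_det m n d / 2 + dotp b (crossp (rC m) (rC n)).
Proof. by move/slides0_axis->; rewrite /join_det; vec_field. Qed.

Lemma scaled_shiftP m n x b d s s' sx t :
  slides m b d s 0 -> slides n b d s' 0 -> slides x b d sx t ->
  scaled_shift m n x d = join_det m n d * (rk x * t * dotp d d) / 2.
Proof.
move=> hm hn /slides_dot ->; have := join_baseP hm hn.
move/(canLR (addrK _)) => e; rewrite /scaled_shift -e.
by set D := join_det m n d; set tau := dotp b _; vec_field.
Qed.

Lemma scaled_midP m n x b d s s' sx t : dotp (rC x) d = 0 ->
  slides m b d s 0 -> slides n b d s' 0 -> slides x b d sx t ->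
  scaled_mid m n x d = dotp (rC x) (rC x) * dotp d d *
    (sx * join_det m n d / 2 + dotp b (crossp (rC m) (rC n))).
Proof.
move=> Cd hm hn hx; have e := join_baseP hm hn.
have {}hx := slides_mid Cd hx.
move/(canLR (addrK _)): e => e; rewrite /scaled_mid -{}e.
set D := join_det m n d in hx *; set tau := dotp b (crossp _ _) in hx *.
transitivity (D / 2 * (sx * dotp (rC x) (rC x) * dotp d d)
  + dotp (rC x) (rC x) * dotp d d * tau); last by field.
rewrite hx; set c := dotp (rC x) (rC x); by vec_field.
Qed.

Lemma pair_form_eq0 m n x y b d sm sn sx sy tx ty a_m a_n a_x a_y b_x b_y :
  dotp (rC x) d = 0 -> dotp (rC y) d = 0 ->
  slides m b d sm 0 -> slides n b d sn 0 ->
  slides x b d sx tx -> slides y b d sy ty ->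
  a_m + a_n + a_x + a_y = 0 ->
  a_m * sm + a_n * sn + a_x * sx + a_y * sy + b_x * tx + b_y * ty = 0 ->
  pair_form m n x y a_m a_n a_x a_y b_x b_y d = 0.
Proof.
move=> xd yd hm hn hx hy a0 l0; rewrite /pair_form.
rewrite (scaled_shiftP hm hn hx) (scaled_shiftP hm hn hy).
rewrite (scaled_midP xd hm hn hx) (scaled_midP yd hm hn hy).
rewrite (mid_meet_l n hm) -mulrN (mid_meet_r m hn).
set D := join_det m n d; set tau := dotp b _.
set cx := dotp (rC x) _; set cy := dotp (rC y) _; set dd := dotp d d.
transitivity (cx * cy * rk x * rk y * dd *
  (D / 2 * (a_m * sm + a_n * sn + a_x * sx + a_y * sy + b_x * tx + b_y * ty)
   + tau * (a_m + a_n + a_x + a_y))); first by field.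
by rewrite a0 l0 !mulr0 addr0 mulr0.
Qed.

(** All terms of [pair_form] are quadratic in d, so the vanishing of the form
    passes from the direction of a line to every multiple of it, including the
    cross product in [pair_obstruction]. *)
Lemma pair_formZ m n x y a_m a_n a_x a_y b_x b_y (c : R) d :
  pair_form m n x y a_m a_n a_x a_y b_x b_y (c *: d) =
  c ^+ 2 * pair_form m n x y a_m a_n a_x a_y b_x b_y d.
Proof.
have eD : join_det m n (c *: d) = c * join_det m n d.
  by rewrite /join_det dotpZl.
have eB : join_base m n (c *: d) = c *: join_base m n d.
  by rewrite /join_base; vec_ring.
have es z : scaled_shift m n z (c *: d) = c ^+ 2 * scaled_shift m n z d.
  rewrite /scaled_shift eD eB.
  set D := join_det m n d; set B := join_base _ _ _.
  vec_ring.
have em z : scaled_mid m n z (c *: d) = c ^+ 2 * scaled_mid m n z d.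
  rewrite /scaled_mid eD eB.
  set D := join_det m n d; set B := join_base _ _ _.
  vec_ring.
rewrite /pair_form !es !em dotpZl dotpZr; ring.
Qed.

Lemma crossp_collinear u v d : d != 0 -> dotp u d = 0 -> dotp v d = 0 ->
  crossp u v = (dotp (crossp u v) d / dotp d d) *: d.
Proof.
move=> d0 ud vd; have dd := lt0r_neq0 (dotp_gt0 d0).
apply: (scalerI dd); rewrite scalerA mulrCA divff // mulr1.
apply/eqP; rewrite -subr_eq0; apply/eqP.
transitivity (crossp d (dotp u d *: v - dotp v d *: u)); first by vec_ring.
by rewrite ud vd; vec_ring.
Qed.

Lemma pair_obstruction_eq0 m n x y b d sm sn sx sy tx ty
    a_m a_n a_x a_y b_x b_y :
  d != 0 -> dotp (rC x) d = 0 -> dotp (rC y) d = 0 ->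
  slides m b d sm 0 -> slides n b d sn 0 ->
  slides x b d sx tx -> slides y b d sy ty ->
  a_m + a_n + a_x + a_y = 0 ->
  a_m * sm + a_n * sn + a_x * sx + a_y * sy + b_x * tx + b_y * ty = 0 ->
  pair_obstruction m n x y a_m a_n a_x a_y b_x b_y = 0.
Proof.
move=> d0 xd yd hm hn hx hy a0 l0.
rewrite /pair_obstruction (crossp_collinear d0 xd yd) pair_formZ.
by rewrite (pair_form_eq0 xd yd hm hn hx hy a0 l0) mulr0.
Qed.

Lemma three_perp x y m d : d != 0 -> dotp (rC x) d = 0 -> dotp (rC y) d = 0 ->
  dotp (rC m) d = 0 -> dotp (rC m) (crossp (rC x) (rC y)) = 0.
Proof.
by move=> d0 xd yd md; rewrite (crossp_collinear d0 xd yd) dotpZr md mulr0.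
Qed.

End Pairs.

(** * Lines carried by four rotors *)

Section Obstruction.
Variable R : realType.
Implicit Types (x : rotor R) (b d : 'cV[R]_3) (s t : R).

(** After k and the triple product of axis vectors come the obstructions for
    lines with a non-zero shift at x0 only, then at x0 and x1, then at x0 and
    x2; the pair obstructions follow the three cases of [balanced]. *)
Definition obstruction_at x0 x1 x2 x3 : seq R :=
  [:: rk x0; dotp (rC x2) (crossp (rC x0) (rC x1));
      slide_resultant x0 x1 x2 x3; foot_resultant x0 x1 x2 x3;
      pair_obstruction x2 x3 x0 x1 0 0 0 0 1 1;
      pair_obstruction x2 x3 x0 x1 0 (-1) 0 1 1 0;
      pair_obstruction x2 x3 x0 x1 1 0 (-1) 0 0 1;
      pair_obstruction x1 x3 x0 x2 0 0 0 0 1 1;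
      pair_obstruction x1 x3 x0 x2 1 (-1) 0 0 1 (-1);
      pair_obstruction x1 x3 x0 x2 0 0 (-1) 1 0 0].

Definition unobstructed x0 x1 x2 x3 : bool :=
  all (fun c => c != 0) (obstruction_at x0 x1 x2 x3).

(** The relations e_0 + e_1 + e_2 + e_3 = 0, e_0 + e_1 = e_2 + e_3 and
    e_0 + e_3 = e_1 + e_2 between the edge lengths
    e_i = (s_i + t_i - s_(i-1) + t_(i-1)) / 2. *)
Definition balanced (s0 s1 s2 s3 t0 t1 t2 t3 : R) : Prop :=
  [\/ t0 + t1 + t2 + t3 = 0, s1 - s3 + t0 - t2 = 0 | s2 - s0 + t1 - t3 = 0].

Lemma balanced_shift s0 s1 s2 s3 t0 t1 t2 t3 :
  balanced s0 s1 s2 s3 t0 t1 t2 t3 -> balanced s1 s2 s3 s0 t1 t2 t3 t0.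
Proof.
case=> h.
- by apply: Or31; lra.
- by apply: Or33; lra.
- by apply: Or32; lra.
Qed.

(** Each of these patterns of non-zero shifts makes an entry of
    [obstruction_at] vanish. *)
Lemma unobstructed_no_slide x0 x1 x2 x3 b d s0 s1 s2 s3 t0 t1 t2 t3 :
  unobstructed x0 x1 x2 x3 -> d != 0 ->
  (t0 != 0 -> dotp (rC x0) d = 0) -> (t1 != 0 -> dotp (rC x1) d = 0) ->
  (t2 != 0 -> dotp (rC x2) d = 0) ->
  slides x0 b d s0 t0 -> slides x1 b d s1 t1 ->
  slides x2 b d s2 t2 -> slides x3 b d s3 t3 ->
  balanced s0 s1 s2 s3 t0 t1 t2 t3 ->
  [/\ ~~ [&& t0 != 0, t1 == 0, t2 == 0 & t3 == 0],
      ~~ [&& t0 != 0, t1 != 0, t2 == 0 & t3 == 0],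
      ~~ [&& t0 != 0, t1 == 0, t2 != 0 & t3 == 0] &
      ~~ [&& t0 != 0, t1 != 0 & t2 != 0]].
Proof.
rewrite /unobstructed /= !andbT.
move=> /and5P[_ D F1 F2 /and5P[A1 A2 A3 O1 /andP[O2 O3]]].
move=> d0 p0 p1 p2 h0 h1 h2 h3 bal; split; apply/negP.
- case/and4P=> n0 /eqP z1 /eqP z2 /eqP z3; subst t1 t2 t3.
  case: bal => e.
  + by case/eqP: n0; lra.
  + case/eqP: F1; apply: (slide_resultant_eq0 (p0 n0) h0 h1 h2 h3); lra.
  + have es : s2 = s0 by lra.
    by case/eqP: F2; subst s2; apply: (foot_resultant_eq0 h0 h1 h2 h3).
- case/and4P=> n0 n1 /eqP z2 /eqP z3; subst t2 t3.
  case: bal => e; [case/eqP: A1 | case/eqP: A2 | case/eqP: A3];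
    by apply: (pair_obstruction_eq0 d0 (p0 n0) (p1 n1) h2 h3 h0 h1); lra.
- case/and4P=> n0 /eqP z1 n2 /eqP z3; subst t1 t3.
  case: bal => e; [case/eqP: O1 | case/eqP: O2 | case/eqP: O3];
    by apply: (pair_obstruction_eq0 d0 (p0 n0) (p2 n2) h1 h3 h0 h2); lra.
- case/and3P=> n0 n1 n2.
  by case/eqP: D; apply: (three_perp d0 (p0 n0) (p1 n1) (p2 n2)).
Qed.

(** Up to a cyclic permutation of the rotors, every non-empty pattern of
    non-zero shifts is among the four in [unobstructed_no_slide]. *)
Lemma unobstructed_meets_all x0 x1 x2 x3 b d s0 s1 s2 s3 t0 t1 t2 t3 :
  unobstructed x0 x1 x2 x3 -> unobstructed x1 x2 x3 x0 ->
  unobstructed x2 x3 x0 x1 -> unobstructed x3 x0 x1 x2 ->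
  dotp (rC x0) (rN x0) = 0 -> dotp (rC x1) (rN x1) = 0 ->
  dotp (rC x2) (rN x2) = 0 -> dotp (rC x3) (rN x3) = 0 ->
  d != 0 ->
  slides x0 b d s0 t0 -> slides x1 b d s1 t1 ->
  slides x2 b d s2 t2 -> slides x3 b d s3 t3 ->
  balanced s0 s1 s2 s3 t0 t1 t2 t3 ->
  [/\ t0 = 0, t1 = 0, t2 = 0 & t3 = 0].
Proof.
move=> u0 u1 u2 u3 c0 c1 c2 c3 d0 h0 h1 h2 h3 bal0.
have p0 n := slides_perp c0 (proj1 (andP u0)) n h0.
have p1 n := slides_perp c1 (proj1 (andP u1)) n h1.
have p2 n := slides_perp c2 (proj1 (andP u2)) n h2.
have p3 n := slides_perp c3 (proj1 (andP u3)) n h3.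
have bal1 := balanced_shift bal0; have bal2 := balanced_shift bal1.
have bal3 := balanced_shift bal2.
have := unobstructed_no_slide u0 d0 p0 p1 p2 h0 h1 h2 h3 bal0.
have := unobstructed_no_slide u1 d0 p1 p2 p3 h1 h2 h3 h0 bal1.
have := unobstructed_no_slide u2 d0 p2 p3 p0 h2 h3 h0 h1 bal2.
have := unobstructed_no_slide u3 d0 p3 p0 p1 h3 h0 h1 h2 bal3.
clear.
case: (eqVneq t0 0) => ?; case: (eqVneq t1 0) => ?;
case: (eqVneq t2 0) => ?; case: (eqVneq t3 0) => ? //=;
by do 4![case=> ? ? ? ?].
Qed.

End Obstruction.

(** * The rotor of a displacement *)

Section Kinematics.
Variable R : realType.
Implicit Types (M : 'M[R]_3) (g : displacement R) (X : point R).

Lemma mulmx3E M (u : 'cV[R]_3) i :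
  (M *m u) i 0 = M i 0 * u 0 0 + M i 1 * u 1 0 + M i 2%:R * u 2%:R 0.
Proof. by rewrite mxE sum3E. Qed.

Lemma trace3E M : \tr M = M 0 0 + M 1 1 + M 2%:R 2%:R.
Proof. exact: sum3E. Qed.

Lemma det3E M : \det M =
  M 0 0 * (M 1 1 * M 2%:R 2%:R - M 1 2%:R * M 2%:R 1)
  - M 0 1 * (M 1 0 * M 2%:R 2%:R - M 1 2%:R * M 2%:R 0)
  + M 0 2%:R * (M 1 0 * M 2%:R 1 - M 1 1 * M 2%:R 0).
Proof.
rewrite (expand_det_row M 0) sum3E /cofactor.
rewrite !(expand_det_row _ 0) !big_ord_recl !big_ord0 /cofactor.
rewrite !det_mx11 !mxE /=.
pose m (i j : nat) := M (inord i) (inord j).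
have mE i j : M i j = m i j by rewrite /m !inord_val.
rewrite !mE /= /bump /=; ring.
Qed.

(** The vector C with (M - M^T) X = C x X. *)
Definition axial M : 'cV[R]_3 :=
  \col_(k < 3) (M (k + 2%:R) (k + 1) - M (k + 1) (k + 2%:R)).

Lemma axial_0 M : axial M 0 0 = M 2%:R 1 - M 1 2%:R.
Proof. by rewrite mxE !add0r. Qed.

Lemma axial_1 M : axial M 1 0 = M 0 2%:R - M 2%:R 0.
Proof. by rewrite mxE; congr (M _ _ - M _ _); apply: val_inj. Qed.

Lemma axial_2 M : axial M 2%:R 0 = M 1 0 - M 0 1.
Proof. by rewrite mxE; congr (M _ _ - M _ _); apply: val_inj. Qed.

Definition matE := (mulmx3E, trace3E, axial_0, axial_1, axial_2).

Definition rotor_of g : rotor R :=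
  let k := 1 + \tr (rot g) in
  let C := axial (rot g) in
  Rotor k C (2^-1 *: (k *: trans g - crossp C (trans g))).

(** Each row r and the cross product w of the other two are unit vectors with
    r . w = 1, so |r - w|^2 = 0. *)
Lemma SO3_rows M : M^T *m M = 1%:M -> \det M = 1 ->
  let r k := col k M^T in
  [/\ r 0 = crossp (r 1) (r 2%:R), r 1 = crossp (r 2%:R) (r 0) &
      r 2%:R = crossp (r 0) (r 1)].
Proof.
move=> /mulmx1C MM; rewrite det3E => dM r.
have rE k i : r k i 0 = M k i by rewrite !mxE.
have rr i j : dotp (r i) (r j) = (i == j)%:R.
  move/matrixP: MM => /(_ i j); rewrite !mxE => <-.
  by apply: eq_bigr => k _; rewrite !mxE.
have rd : dotp (r 0) (crossp (r 1) (r 2%:R)) = 1.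
  by rewrite -dM !vecE !rE; ring.
have main i j k : i != j -> i != k -> j != k ->
    dotp (r i) (crossp (r j) (r k)) = 1 -> r i = crossp (r j) (r k).
  move=> ij ik jk d1; apply/eqP; rewrite -subr_eq0; apply/eqP/dotp_eq0.
  set w := crossp _ _ in d1 *.
  have ww : dotp w w = 1.
    transitivity (dotp (r j) (r j) * dotp (r k) (r k) - dotp (r j) (r k) ^+ 2).
      by rewrite /w; vec_ring.
    by rewrite !rr !eqxx (negPf jk) /=; ring.
  transitivity (dotp (r i) (r i) - 2 * dotp (r i) w + dotp w w).
    by vec_ring.
  by rewrite d1 ww rr eqxx /=; ring.
by split; apply: main => //; rewrite -rd; vec_ring.
Qed.

(** Cayley's parametrization of rotations: (1 + tr M) (M - 1) is the product
    of the matrix of C x _ and M + 1.  The entries of the two sides differ by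
    orthogonality relations and the cofactor relations of [SO3_rows]. *)
Lemma rotor_ofP g X : let x := rotor_of g in
  rk x *: (act g X - X) = crossp (rC x) (act g X + X) + 2 *: rN x.
Proof.
have /andP[/eqP MM /eqP dM] := rot_SO3 g.
have [r0 r1 r2] := SO3_rows MM dM.
have rE k i : (col k (rot g)^T) i 0 = rot g k i by rewrite !mxE.
move/matrixP: MM => MM.
have MME i j : rot g 0 i * rot g 0 j + rot g 1 i * rot g 1 j
    + rot g 2%:R i * rot g 2%:R j = (i == j)%:R.
  by have := MM i j; rewrite !mxE sum3E !mxE.
set M := rot g in r0 r1 r2 rE MME *.
have e00 := congr1 (fun u : 'cV[R]_3 => u 0 0) r0.
have e01 := congr1 (fun u : 'cV[R]_3 => u 1 0) r0.
have e02 := congr1 (fun u : 'cV[R]_3 => u 2%:R 0) r0.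
have e10 := congr1 (fun u : 'cV[R]_3 => u 0 0) r1.
have e11 := congr1 (fun u : 'cV[R]_3 => u 1 0) r1.
have e12 := congr1 (fun u : 'cV[R]_3 => u 2%:R 0) r1.
have e20 := congr1 (fun u : 'cV[R]_3 => u 0 0) r2.
have e21 := congr1 (fun u : 'cV[R]_3 => u 1 0) r2.
have e22 := congr1 (fun u : 'cV[R]_3 => u 2%:R 0) r2.
rewrite !vecE !rE in e00 e01 e02 e10 e11 e12 e20 e21 e22.
have rel (Y : 'cV[R]_3) :
    (1 + \tr M) *: (M *m Y - Y) = crossp (axial M) (M *m Y + Y).
  have f00 := MME 0 0; have f11 := MME 1 1; have f22 := MME 2%:R 2%:R.
  have f01 := MME 0 1; have f02 := MME 0 2%:R; have f12 := MME 1 2%:R.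
  rewrite /= in f00 f11 f22 f01 f02 f12.
  (* The nine entries of (1 + tr M) (M - 1) = [C] (M + 1). *)
  have h00 : (1 + (M 0 0 + M 1 1 + M 2%:R 2%:R)) * (M 0 0 - 1) =
      (M 0 2%:R - M 2%:R 0) * (M 2%:R 0)
      - (M 1 0 - M 0 1) * (M 1 0) by lra.
  have h01 : (1 + (M 0 0 + M 1 1 + M 2%:R 2%:R)) * (M 0 1) =
      (M 0 2%:R - M 2%:R 0) * (M 2%:R 1)
      - (M 1 0 - M 0 1) * (M 1 1 + 1) by lra.
  have h02 : (1 + (M 0 0 + M 1 1 + M 2%:R 2%:R)) * (M 0 2%:R) =
      (M 0 2%:R - M 2%:R 0) * (M 2%:R 2%:R + 1)
      - (M 1 0 - M 0 1) * (M 1 2%:R) by lra.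
  have h10 : (1 + (M 0 0 + M 1 1 + M 2%:R 2%:R)) * (M 1 0) =
      (M 1 0 - M 0 1) * (M 0 0 + 1)
      - (M 2%:R 1 - M 1 2%:R) * (M 2%:R 0) by lra.
  have h11 : (1 + (M 0 0 + M 1 1 + M 2%:R 2%:R)) * (M 1 1 - 1) =
      (M 1 0 - M 0 1) * (M 0 1)
      - (M 2%:R 1 - M 1 2%:R) * (M 2%:R 1) by lra.
  have h12 : (1 + (M 0 0 + M 1 1 + M 2%:R 2%:R)) * (M 1 2%:R) =
      (M 1 0 - M 0 1) * (M 0 2%:R)
      - (M 2%:R 1 - M 1 2%:R) * (M 2%:R 2%:R + 1) by lra.
  have h20 : (1 + (M 0 0 + M 1 1 + M 2%:R 2%:R)) * (M 2%:R 0) =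
      (M 2%:R 1 - M 1 2%:R) * (M 1 0)
      - (M 0 2%:R - M 2%:R 0) * (M 0 0 + 1) by lra.
  have h21 : (1 + (M 0 0 + M 1 1 + M 2%:R 2%:R)) * (M 2%:R 1) =
      (M 2%:R 1 - M 1 2%:R) * (M 1 1 + 1)
      - (M 0 2%:R - M 2%:R 0) * (M 0 1) by lra.
  have h22 : (1 + (M 0 0 + M 1 1 + M 2%:R 2%:R)) * (M 2%:R 2%:R - 1) =
      (M 2%:R 1 - M 1 2%:R) * (M 1 2%:R)
      - (M 0 2%:R - M 2%:R 0) * (M 0 2%:R) by lra.
  clear -h00 h01 h02 h10 h11 h12 h20 h21 h22.
  pose times (j : 'I_3) (c : R) := c * Y j 0.
  apply: colP3; rewrite !(vecE, matE).
  - move/(congr1 (times 0)): h00; move/(congr1 (times 1)): h01.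
    by move/(congr1 (times 2%:R)): h02; rewrite /times; clear; lra.
  - move/(congr1 (times 0)): h10; move/(congr1 (times 1)): h11.
    by move/(congr1 (times 2%:R)): h12; rewrite /times; clear; lra.
  - move/(congr1 (times 0)): h20; move/(congr1 (times 1)): h21.
    by move/(congr1 (times 2%:R)): h22; rewrite /times; clear; lra.
rewrite /= /act -/M; apply/eqP; rewrite -subr_eq0.
rewrite (_ : _ - (_ + 2 *: _) =
  (1 + \tr M) *: (M *m X - X) - crossp (axial M) (M *m X + X)).
  by rewrite rel subrr.
set k := 1 + _; set C := axial M; set Y := M *m X.
vec_field.
Qed.

(** If N = X x C, then the difference v of X and its image satisfies
    k v = C x v, so v is orthogonal to itself. *)
Lemma rotor_of_fixed g X : rk (rotor_of g) != 0 ->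
  act g X = X <-> rN (rotor_of g) = crossp X (rC (rotor_of g)).
Proof.
move=> k0; have := rotor_ofP g X; set x := rotor_of g in k0 * => e.
split=> [gX | NX].
  have {e} : 2 *: rN x = 2 *: crossp X (rC x).
    apply/eqP; rewrite -subr_eq0; apply/eqP; rewrite gX in e.
    transitivity (rk x *: (X - X)); last by vec_ring.
    by rewrite e; vec_ring.
  by apply: scalerI; rewrite pnatr_eq0.
have {}e : rk x *: (act g X - X) = crossp (rC x) (act g X - X).
  by rewrite e NX; vec_ring.
have : rk x * dotp (act g X - X) (act g X - X) = 0.
  by rewrite -dotpZr e; vec_ring.
move/eqP; rewrite mulf_eq0 (negPf k0) => /eqP/dotp_eq0/eqP.
by rewrite subr_eq0 => /eqP.
Qed.

Lemma rotor_of_pure g l : rk (rotor_of g) != 0 -> rotation_about g l ->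
  dotp (rC (rotor_of g)) (rN (rotor_of g)) = 0.
Proof.
move=> k0 /(_ (base l)) [_ gl].
have /gl/(rotor_of_fixed _ k0) -> : on_line l (base l).
  by exists 0; rewrite scale0r addr0.
by vec_ring.
Qed.

Lemma axis_pointP (x : rotor R) (u : 'cV[R]_3) :
  rC x != 0 -> dotp (rC x) (rN x) = 0 ->
  rN x = crossp u (rC x) <->
  exists t, u = (dotp (rC x) (rC x))^-1 *: crossp (rC x) (rN x) + t *: rC x.
Proof.
move=> C0 CN; have cc := lt0r_neq0 (dotp_gt0 C0).
split=> [/axis_point e | [t ->]].
  exists ((dotp (rC x) (rC x))^-1 * dotp (rC x) u).
  by rewrite -scalerA -scalerDr -e scalerA mulVf // scale1r.
apply: (scalerI cc).
transitivity (dotp (rC x) (rC x) *: rN x - dotp (rC x) (rN x) *: rC x).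
  by rewrite CN scale0r subr0.
transitivity (crossp (crossp (rC x) (rN x)) (rC x)); first by vec_ring.
rewrite -[X in crossp X _ = _]scale1r -(mulfV cc); set c := dotp _ _ : R.
vec_ring.
Qed.

Lemma rotation_of_pure g : rk (rotor_of g) != 0 -> rC (rotor_of g) != 0 ->
  dotp (rC (rotor_of g)) (rN (rotor_of g)) = 0 ->
  exists l, rotation_about g l.
Proof.
set x := rotor_of g => k0 C0 CN.
exists (OLine ((dotp (rC x) (rC x))^-1 *: crossp (rC x) (rN x)) C0) => X.
exact: iff_trans (rotor_of_fixed X k0) (axis_pointP X C0 CN).
Qed.

Section Quadruple.
Variable a : quadruple R.

(** The relative displacement seen from the moving space: its fixed points are
    the points of the relative revolute axis. *)
Definition moving_displacement (i : 'I_4) : displacement R :=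
  disp_comp (disp_inv (a i)) (a (i + 1)).

Definition moving_rotor (i : 'I_4) : rotor R :=
  rotor_of (moving_displacement i).

Lemma act_invK g X : act g (act (disp_inv g) X) = X.
Proof.
rewrite /act /= mulmxDr mulmxA (mulmx1C (rot_orth g)) mul1mx.
by rewrite mulmxN mulmxA (mulmx1C (rot_orth g)) mul1mx subrK.
Qed.

Lemma moving_displacementE i X Y :
  act (a i) X = act (a (i + 1)) Y <-> act (moving_displacement i) Y = X.
Proof.
rewrite /moving_displacement act_comp.
by split=> [<- | <-]; rewrite ?act_inv ?act_invK.
Qed.

Lemma on_relative_axisE i X : rk (moving_rotor i) != 0 ->
  on_relative_axis a i X <->
  rN (moving_rotor i) = crossp X (rC (moving_rotor i)).
Proof.
by move=> k0; rewrite /on_relative_axis moving_displacementE rotor_of_fixed.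
Qed.

Lemma act_line g (l : oline R) t :
  act g (base l + t *: dir l) =
  base (line_image g l) + t *: dir (line_image g l).
Proof. by rewrite /act /= mulmxDr -scalemxAr addrAC. Qed.

(** The two relative displacements are conjugate by alpha_i. *)
Lemma moving_rotation i :
  (exists l, rotation_about (relative_displacement a i) l) <->
  (exists l, rotation_about (moving_displacement i) l).
Proof.
split=> -[l rl].
  exists (line_image (disp_inv (a i)) l) => X.
  rewrite -moving_displacementE.
  transitivity (act (relative_displacement a i) (act (a i) X) = act (a i) X).
    by rewrite act_comp act_inv; split=> ->.
  rewrite rl; split=> -[t].
    move/(congr1 (act (disp_inv (a i)))); rewrite act_inv act_line => ->.
    by exists t.
  by rewrite -act_line => ->; exists t; rewrite act_invK.
exists (line_image (a i) l) => X.
transitivity (act (moving_displacement i) (act (disp_inv (a i)) X)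
  = act (disp_inv (a i)) X).
  rewrite -moving_displacementE act_invK act_comp.
  by split=> /esym.
rewrite rl; split=> -[t].
  by move/(congr1 (act (a i))); rewrite act_invK act_line => ->; exists t.
by rewrite -act_line => ->; exists t; rewrite act_inv.
Qed.

Lemma moving_slides i (b d : 'cV[R]_3) (p q : R) :
  act (a i) (b + p *: d) = act (a (i + 1)) (b + q *: d) ->
  slides (moving_rotor i) b d (p + q) (p - q).
Proof.
move/moving_displacementE => e.
have := rotor_ofP (moving_displacement i) (b + q *: d); rewrite e /slides.
rewrite -/(moving_rotor i); set x := moving_rotor i.
rewrite (_ : _ - _ = (p - q) *: d); last by vec_ring.
by rewrite scalerA => ->; congr (crossp _ _ + _); vec_ring.
Qed.

End Quadruple.

End Kinematics.

(** * Closed skew polygons and rulings *)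

Section Quadrilaterals.
Variable R : realType.
Implicit Types (u v w : 'cV[R]_3) (L : 'I_4 -> point R).

(** Six times the signed volume of the tetrahedron with vertices L. *)
Definition volume L : R :=
  dotp (L 1 - L 0) (crossp (L 2%:R - L 0) (L 3%:R - L 0)).

Lemma cramer3 u1 u2 u3 w :
  dotp u1 (crossp u2 u3) *: w =
  dotp w u1 *: crossp u2 u3 + dotp w u2 *: crossp u3 u1
  + dotp w u3 *: crossp u1 u2.
Proof. vec_ring. Qed.

Lemma coplanarP L : coplanar L <-> volume L = 0.
Proof.
split=> [[w [c [w0 wL]]] | vol0].
  have wd i : dotp w (L i - L 0) = 0 by rewrite dotpBr !wL subrr.
  have : volume L *: w = 0.
    by rewrite /volume cramer3 !wd !scale0r !addr0.
  by move/eqP; rewrite scaler_eq0 (negPf w0) orbF => /eqP.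
pose edges := [:: L 1 - L 0; L 2%:R - L 0; L 3%:R - L 0].
pose A : 'M[R]_3 := \matrix_(i, j) (nth 0 edges j) i 0.
have dA : \det A = 0.
  by rewrite det3E !mxE -vol0 /volume vecE; vec_ring.
move/eqP/det0P: dA => [v v0 vA].
exists v^T, (dotp v^T (L 0)); split.
  by apply: contra v0 => /eqP vT; rewrite -(trmxK v) vT trmx0.
have dv (j : 'I_3) : dotp v^T (nth 0 edges j) = 0.
  move/matrixP/(_ 0 j): vA; rewrite !mxE => vA; rewrite -[RHS]vA.
  by apply: eq_bigr => k _; rewrite !mxE.
elim/ord4_cases => //; apply/eqP; rewrite -subr_eq0 -dotpBr.
- by rewrite (dv 0).
- by rewrite (dv 1).
- by rewrite (dv 2%:R).
Qed.

(** The longest side of a closed polygon has the total length of the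
    three others only if all directions agree: after elimination of w0, the
    scalar product with f0 is, up to sign, a sum of terms w_i |f_i - f0|^2 / 2
    of equal sign. *)
Lemma equality_in_triangle (f0 f1 f2 f3 : 'cV[R]_3) (w0 w1 w2 w3 dd : R) :
  dotp f0 f0 = dd -> dotp f1 f1 = dd -> dotp f2 f2 = dd -> dotp f3 f3 = dd ->
  0 < w1 * w2 -> 0 < w1 * w3 -> w0 + w1 + w2 + w3 = 0 ->
  w0 *: f0 + w1 *: f1 + w2 *: f2 + w3 *: f3 = 0 ->
  [/\ f1 = f0, f2 = f0 & f3 = f0].
Proof.
move=> n0 n1 n2 n3 s12 s13 w_0 f_0.
have dist f : dotp f f = dd ->
  dotp (f - f0) (f - f0) = 2 * (dd - dotp f f0).
  move=> nf; transitivity (dotp f f + dotp f0 f0 - 2 * dotp f f0).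
    by vec_ring.
  by rewrite nf n0; ring.
have key : w1 * dotp (f1 - f0) (f1 - f0) + w2 * dotp (f2 - f0) (f2 - f0)
    + w3 * dotp (f3 - f0) (f3 - f0) = 0.
  rewrite (dist _ n1) (dist _ n2) (dist _ n3).
  move/(congr1 (dotp f0)): f_0; rewrite !dotpDr !dotpZr n0.
  rewrite (dotpC f1) (dotpC f2) (dotpC f3).
  have -> : w0 = - (w1 + w2 + w3) by lra.
  rewrite (_ : dotp f0 0 = 0); last by vec_ring.
  by lra.
have g1 := dotp_ge0 (f1 - f0); have g2 := dotp_ge0 (f2 - f0).
have g3 := dotp_ge0 (f3 - f0).
have w1sq : 0 < w1 * w1 by nra.
have key2 : (w1 * w1) * dotp (f1 - f0) (f1 - f0)
    + (w1 * w2) * dotp (f2 - f0) (f2 - f0)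
    + (w1 * w3) * dotp (f3 - f0) (f3 - f0) = 0.
  by transitivity (w1 * 0); [rewrite -key; ring | rewrite mulr0].
have zero f : dotp (f - f0) (f - f0) = 0 -> f = f0.
  by move/dotp_eq0/eqP; rewrite subr_eq0 => /eqP.
have m1 := mulr_ge0 (ltW w1sq) g1; have m2 := mulr_ge0 (ltW s12) g2.
have m3 := mulr_ge0 (ltW s13) g3.
split; apply: zero.
- apply: (mulfI (lt0r_neq0 w1sq)); rewrite mulr0; lra.
- apply: (mulfI (lt0r_neq0 s12)); rewrite mulr0; lra.
- apply: (mulfI (lt0r_neq0 s13)); rewrite mulr0; lra.
Qed.

(** The scalar product with n gives a vanishing sum of the e_i with signs.  Its
    summands cannot all be positive or all be negative, and if three of them
    have the same sign, then the polygon degenerates by [equality_in_triangle].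
    The other sign patterns are those of the conclusion. *)
Lemma alternating_closed_polygon (D0 D1 D2 D3 n : 'cV[R]_3)
    (e0 e1 e2 e3 dd : R) :
  dotp D0 D0 = dd -> dotp D1 D1 = dd -> dotp D2 D2 = dd -> dotp D3 D3 = dd ->
  crossp D0 D1 != 0 ->
  e0 * e1 < 0 -> e1 * e2 < 0 -> e2 * e3 < 0 ->
  e0 *: D0 + e1 *: D1 + e2 *: D2 + e3 *: D3 = 0 ->
  dotp n D0 != 0 ->
  dotp n D1 ^+ 2 = dotp n D0 ^+ 2 -> dotp n D2 ^+ 2 = dotp n D0 ^+ 2 ->
  dotp n D3 ^+ 2 = dotp n D0 ^+ 2 ->
  [\/ e0 + e1 + e2 + e3 = 0, e0 + e1 = e2 + e3 | e0 + e3 = e1 + e2].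
Proof.
move=> n0 n1 n2 n3 nz e01 e12 e23 D_0 h0.
have sumE := congr1 (dotp n) D_0; move: sumE.
rewrite !dotpDr !dotpZr (_ : dotp n 0 = 0); last by vec_ring.
have nN (u : 'cV[R]_3) : dotp u u = dd -> dotp (- u) (- u) = dd.
  by move=> <-; vec_ring.
have cN (u v : 'cV[R]_3) : u = v -> crossp u v = 0 by move=> ->; vec_ring.
have cN' (u v : 'cV[R]_3) : u = - v -> crossp u v = 0 by move=> ->; vec_ring.
have e03 : e0 * e3 < 0 by nra.
have e02 : 0 < e0 * e2 by nra.
have e13 : 0 < e1 * e3 by nra.
have h (c : R) : dotp n D0 * c = 0 -> c = 0.
  by move/eqP; rewrite mulf_eq0 (negPf h0) => /eqP.
move=> s /eqP; rewrite eqf_sqr => /orP[] /eqP s1;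
  move=> /eqP; rewrite eqf_sqr => /orP[] /eqP s2;
  move=> /eqP; rewrite eqf_sqr => /orP[] /eqP s3; rewrite s1 s2 s3 in s.
- by apply: Or31; apply: h; rewrite -s; ring.
- case/eqP: nz; apply: cN.
  have [] // := @equality_in_triangle D1 D0 D2 (- D3) e1 e0 e2 (- e3) dd;
    rewrite ?nN //; first nra.
    by apply: h; rewrite -s; ring.
  by rewrite -[RHS]D_0; vec_ring.
- case/eqP: nz; apply: cN.
  have [] // := @equality_in_triangle D0 D1 (- D2) D3 e0 e1 (- e2) e3 dd;
    rewrite ?nN //; first nra.
    by apply: h; rewrite -s; ring.
  by rewrite -[RHS]D_0; vec_ring.
- by apply: Or32; apply/eqP; rewrite -subr_eq0; apply/eqP/h; rewrite -s; ring.
- case/eqP: nz; apply: cN'.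
  have [] // := @equality_in_triangle D3 D0 (- D1) D2 e3 e0 (- e1) e2 dd;
    rewrite ?nN //; first nra.
  + by apply: h; rewrite -s; ring.
  + by rewrite -[RHS]D_0; vec_ring.
  + by move=> -> ->.
- have : e0 - e1 + e2 - e3 = 0 by apply: h; rewrite -s; ring.
  by move/(congr1 ( *%R e0)) => e; nra.
- by apply: Or33; apply/eqP; rewrite -subr_eq0; apply/eqP/h; rewrite -s; ring.
- case/eqP: nz; apply: cN'.
  have [] // := @equality_in_triangle (- D2) D0 (- D1) (- D3)
    (- e2) e0 (- e1) (- e3) dd; rewrite ?nN //; [nra | nra | | |].
  + by apply: h; rewrite -s; ring.
  + by rewrite -[RHS]D_0; vec_ring.
  + by move=> -> ->.
Qed.

(** The coefficient of t^2 in the equation of the hyperboloid vanishes along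
    each of its lines.  Hence all rulings make the same angle with the axis. *)
Lemma hyperboloid_ruling (c n B D : 'cV[R]_3) (p q : R) : 0 < p -> 0 < q ->
  (forall t, on_hyperboloid c n p q (B + t *: D)) ->
  dotp n D ^+ 2 * (p ^+ 2 + q ^+ 2) = q ^+ 2 * dotp D D.
Proof.
move=> p0 q0 H.
have e : dotp n D ^+ 2 * (p ^+ 2 + q ^+ 2) - q ^+ 2 * dotp D D = 0.
  have := H 1; have := H (-1); have := H 0; rewrite /on_hyperboloid.
  rewrite (_ : B + 0 *: D - c = B - c); last by vec_ring.
  rewrite (_ : B + -1 *: D - c = (B - c) - D); last by vec_ring.
  rewrite (_ : B + 1 *: D - c = (B - c) + D); last by vec_ring.
  move: (B - c) => w.
  have ex (s : R) : dotp (w + s *: D) (w + s *: D) =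
    dotp w w + 2 * s * dotp w D + s ^+ 2 * dotp D D by vec_ring.
  have := ex 1; have := ex (-1); rewrite scaleN1r scale1r => -> ->.
  rewrite !(dotpDr, dotpNr) => h0 h1 h2.
  have e : (dotp D D - dotp n D ^+ 2) / p ^+ 2 - dotp n D ^+ 2 / q ^+ 2 = 0.
    by lra.
  have /andP[p2 q2] : (p != 0) && (q != 0) by rewrite !lt0r_neq0.
  transitivity (- (p ^+ 2 * q ^+ 2) * ((dotp D D - dotp n D ^+ 2) / p ^+ 2
    - dotp n D ^+ 2 / q ^+ 2)); last by rewrite e mulr0.
  by field; apply/andP.
by apply/eqP; rewrite -subr_eq0 e.
Qed.

End Quadrilaterals.

Section ClosedPolygons.
Variable R : realType.
Implicit Types (u v w : 'cV[R]_3) (L : 'I_4 -> point R).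

Variables (L : 'I_4 -> point R) (D : 'I_4 -> 'cV[R]_3) (e : 'I_4 -> R).
Hypothesis edge0 : L 0 - L 3%:R = e 0 *: D 0.
Hypothesis edge1 : L 1 - L 0 = e 1 *: D 1.
Hypothesis edge2 : L 2%:R - L 1 = e 2%:R *: D 2%:R.
Hypothesis edge3 : L 3%:R - L 2%:R = e 3%:R *: D 3%:R.

Lemma polygon_closed :
  e 0 *: D 0 + e 1 *: D 1 + e 2%:R *: D 2%:R + e 3%:R *: D 3%:R = 0.
Proof. by rewrite -edge0 -edge1 -edge2 -edge3; vec_ring. Qed.

Lemma volume_edges123 : volume L =
  e 1 * e 2%:R * e 3%:R * dotp (D 1) (crossp (D 2%:R) (D 3%:R)).
Proof.
transitivity (dotp (e 1 *: D 1) (crossp (e 2%:R *: D 2%:R) (e 3%:R *: D 3%:R))).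
  by rewrite -edge1 -edge2 -edge3 /volume; vec_ring.
by vec_ring.
Qed.

Lemma volume_edges012 : volume L =
  - (e 0 * e 1 * e 2%:R * dotp (D 0) (crossp (D 1) (D 2%:R))).
Proof.
transitivity (- dotp (e 0 *: D 0) (crossp (e 1 *: D 1) (e 2%:R *: D 2%:R))).
  by rewrite -edge0 -edge1 -edge2 /volume; vec_ring.
by vec_ring.
Qed.

Lemma volume_edges230 : volume L =
  - (e 2%:R * e 3%:R * e 0 * dotp (D 2%:R) (crossp (D 3%:R) (D 0))).
Proof.
transitivity
  (- dotp (e 2%:R *: D 2%:R) (crossp (e 3%:R *: D 3%:R) (e 0 *: D 0))).
  by rewrite -edge0 -edge2 -edge3 /volume; vec_ring.
by vec_ring.
Qed.

Hypothesis skewL : volume L != 0.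

Lemma edge_neq0 i : e i != 0.
Proof.
move: skewL; rewrite volume_edges012 oppr_eq0 !mulf_eq0 !negb_or.
move: skewL; rewrite volume_edges123 !mulf_eq0 !negb_or.
move=> /andP[/andP[/andP[? ?] ?] _] /andP[/andP[/andP[? ?] ?] _].
by move: i; elim/ord4_cases.
Qed.

Lemma dir_independent : dotp (D 1) (crossp (D 2%:R) (D 3%:R)) != 0.
Proof.
by move: skewL; rewrite volume_edges123 mulf_eq0 negb_or => /andP[].
Qed.

Lemma adjacent_dirs i : crossp (D i) (D (i + 1)) != 0.
Proof.
have D012 : dotp (D 0) (crossp (D 1) (D 2%:R)) != 0.
  by move: skewL; rewrite volume_edges012 oppr_eq0 mulf_eq0 negb_or => /andP[].
have D230 : dotp (D 2%:R) (crossp (D 3%:R) (D 0)) != 0.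
  by move: skewL; rewrite volume_edges230 oppr_eq0 mulf_eq0 negb_or => /andP[].
have triple0 (u v w : 'cV[R]_3) : dotp u (crossp v w) != 0 -> crossp u v != 0.
  by apply: contra => /eqP uv; apply/eqP;
     transitivity (dotp w (crossp u v)); [vec_ring | rewrite uv; vec_ring].
have triple1 (u v w : 'cV[R]_3) : dotp u (crossp v w) != 0 -> crossp v w != 0.
  by apply: contra => /eqP ->; apply/eqP; vec_ring.
move: i; elim/ord4_cases.
- by rewrite add0r; apply: triple0 D012.
- by rewrite (_ : 1 + 1 = 2%:R); [apply: triple1 D012 | apply: val_inj].
- by rewrite (_ : 2%:R + 1 = 3%:R); [apply: triple0 D230 | apply: val_inj].
- by rewrite (_ : 3%:R + 1 = 0); [apply: triple1 D230 | apply: val_inj].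
Qed.

Lemma dir01_neq0 : crossp (D 0) (D 1) != 0.
Proof. by have := adjacent_dirs 0; rewrite add0r. Qed.

Lemma dir23_neq0 : crossp (D 2%:R) (D 3%:R) != 0.
Proof.
by have := adjacent_dirs 2%:R; rewrite (_ : 2%:R + 1 = 3%:R) //; apply: val_inj.
Qed.

Variable dd : R.
Hypothesis normD : forall i, dotp (D i) (D i) = dd.

Lemma solve3 (u1 u2 u3 : 'cV[R]_3) (a1 a2 a3 : R) :
  dotp u1 (crossp u2 u3) != 0 ->
  exists w, [/\ dotp w u1 = a1, dotp w u2 = a2 & dotp w u3 = a3].
Proof.
move=> u0.
pose v := a1 *: crossp u2 u3 + a2 *: crossp u3 u1 + a3 *: crossp u1 u2.
exists ((dotp u1 (crossp u2 u3))^-1 *: v); rewrite !dotpZl.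
by split; apply: (mulfI u0); rewrite mulVKf // /v; vec_ring.
Qed.

(** The vector m has the scalar product 1 with all D_i: this is a choice for
    three of them, and the closed polygon with zero total length gives the
    fourth.  Then |X|^2 - dd (m . X)^2 vanishes for X = D_i, and a suitable
    linear function b . X + const makes the sum F vanish at the four vertices,
    hence on the four lines.  Centred at c, the quadric is
    |X - c|^2 = dd (m . (X - c))^2 + K.  Here K is the squared distance of c
    from a point of each line, and K = 0 would make all lines pass through c. *)
Lemma quadrilateral_on_hyperboloid : e 0 + e 1 + e 2%:R + e 3%:R = 0 ->
  exists (c : point R) (n : 'cV[R]_3) (p q : R),
    [/\ dotp n n = 1, 0 < p, 0 < q &
        forall i t, on_hyperboloid c n p q (L i + t *: D i)].
Proof.
move=> e_0.
have [m [m1 m2 m3]] := solve3 1 1 1 dir_independent.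
have m0 : dotp m (D 0) = 1.
  move/(congr1 (dotp m)): polygon_closed.
  rewrite !dotpDr !dotpZr m1 m2 m3 (_ : dotp m 0 = 0); last by vec_ring.
  by move=> h; apply: (mulfI (edge_neq0 0)); lra.
have mD i : dotp m (D i) = 1 by elim/ord4_cases: i.
pose Q X := dotp X X - dd * dotp m X ^+ 2.
have [b [b1 b2 b3]] := solve3 (Q (L 0) - Q (L 1)) (Q (L 0) - Q (L 2%:R))
  (Q (L 0) - Q (L 3%:R)) skewL.
pose F X := Q X + dotp b X - (Q (L 0) + dotp b (L 0)).
have FL i : F (L i) = 0.
  by move: b1 b2 b3; rewrite !dotpBr /F => ? ? ?; elim/ord4_cases: i; lra.
pose lin i := 2 * (dotp (L i) (D i) - dd * dotp m (L i)) + dotp b (D i).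
have Fline i t : F (L i + t *: D i) = t * lin i.
  transitivity (F (L i)
    + t * (lin i + 2 * dd * dotp m (L i) * (1 - dotp m (D i)))
    + t ^+ 2 * (dotp (D i) (D i) - dd * dotp m (D i) ^+ 2)).
    by rewrite /F /Q /lin; vec_ring.
  by rewrite FL mD normD; ring.
have Lback i j : L i - L j = e i *: D i -> F (L i + (- e i) *: D i) = 0.
  by move=> h; rewrite scaleNr -h (_ : _ - _ = L j) ?FL //; vec_ring.
have lin0 i : lin i = 0.
  have : F (L i + (- e i) *: D i) = 0.
    by elim/ord4_cases: i; apply: Lback; eassumption.
  rewrite Fline => /eqP; rewrite mulf_eq0 oppr_eq0.
  by rewrite (negPf (edge_neq0 i)) => /eqP.
have {lin0 Lback}Fline i t : F (L i + t *: D i) = 0 by rewrite Fline lin0 mulr0.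
have lagrange i : dd * dotp m m - 1 =
    dotp (crossp m (D i)) (crossp m (D i)).
  transitivity (dotp (D i) (D i) * dotp m m - dotp m (D i) ^+ 2).
    by rewrite normD mD expr1n.
  by vec_ring.
(* By Lagrange's identity this fails only for D_i parallel to m, for all i. *)
have eta_gt0 : 0 < dd * dotp m m - 1.
  rewrite lt0r (lagrange 0) dotp_ge0 andbT -(lagrange 0).
  apply/eqP => z; case/eqP: dir01_neq0.
  have par i : crossp m (D i) = 0 by apply: dotp_eq0; rewrite -lagrange.
  transitivity (dotp m (D 0) *: crossp (D 0) (D 1)).
    by rewrite mD scale1r.
  transitivity (dotp (D 0) (D 0) *: crossp m (D 1)
    + crossp (crossp (crossp m (D 0)) (D 0)) (D 1)); first by vec_ring.
  by rewrite !par scaler0; vec_ring.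
set eta := dd * dotp m m - 1 in eta_gt0 lagrange.
have eta_neq0 := lt0r_neq0 eta_gt0.
pose mu := dotp m b / 2 * dd / eta.
(* The centre solves 2 (c - dd (m . c) m) = - b; the scalar product with m
   determines mu = dd (m . c). *)
pose c := (- 2^-1) *: b + mu *: m.
have mc : dd * dotp m c = mu.
  rewrite /c dotpDr !dotpZr /mu.
  rewrite (_ : dd * _ = dotp m b / 2 * dd * ((dd * dotp m m - eta) / eta)).
    by rewrite /eta opprB addrC subrK mul1r; field.
  by field.
pose K := dotp c c - dd * dotp m c ^+ 2 + (Q (L 0) + dotp b (L 0)).
have centred X : F X = dotp (X - c) (X - c) - dd * dotp m (X - c) ^+ 2 - K.
  rewrite /F /K; set k := Q (L 0) + _.
  transitivity (Q X + dotp b X - k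
    + 2 * (dd * dotp m c - mu) * dotp m X); first by rewrite mc; ring.
  rewrite /Q; rewrite (_ : b = 2 *: (mu *: m - c)).
    vec_ring.
  by rewrite /c; vec_field.
have onF i t : dotp (L i + t *: D i - c) (L i + t *: D i - c) =
    dd * dotp m (L i + t *: D i - c) ^+ 2 + K.
  by move: (Fline i t); rewrite centred => ?; lra.
have foot i : exists t, K = dotp (L i + t *: D i - c) (L i + t *: D i - c).
  exists (- dotp m (L i - c)); rewrite onF.
  rewrite (_ : dotp m _ = dotp m (L i - c) * (1 - dotp m (D i))).
    by rewrite mD subrr; ring.
  by vec_ring.
have K_ge0 : 0 <= K by have [t ->] := foot 0; exact: dotp_ge0.
have K_gt0 : 0 < K.
  rewrite lt0r K_ge0 andbT; apply/eqP => K0.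
  have thru i : exists s, L i - c = s *: D i.
    have [t] := foot i; rewrite K0 => /esym/dotp_eq0 h; exists (- t).
    by apply/eqP; rewrite -subr_eq0 -h; apply/eqP; vec_ring.
  have apex i j : L j - L i = e j *: D j -> crossp (D i) (D j) != 0 -> L i = c.
    move=> ej nz; have [s hs] := thru i; have [s' hs'] := thru j.
    have : s *: crossp (D i) (D j) = 0.
      transitivity (crossp (L i - c) (D j)); first by rewrite hs; vec_ring.
      transitivity (crossp ((L j - c) - (L j - L i)) (D j)); first by vec_ring.
      by rewrite hs' ej; vec_ring.
    move/eqP; rewrite scaler_eq0 (negPf nz) orbF => /eqP s0.
    by apply/eqP; rewrite -subr_eq0 hs s0 scale0r.
  case/eqP: skewL; rewrite /volume.
  rewrite (apex _ _ edge1 dir01_neq0) (apex _ _ edge3 dir23_neq0).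
  vec_ring.
have mm_gt0 : 0 < dotp m m.
  by apply: dotp_gt0; apply: contra_eq_neq m0 => ->; rewrite (_ : dotp 0 _ = 0)
    1?eq_sym ?oner_eq0 //; vec_ring.
have N0 : Num.sqrt (dotp m m) != 0 by rewrite lt0r_neq0 // sqrtr_gt0.
have N2 : Num.sqrt (dotp m m) ^+ 2 = dotp m m by rewrite sqr_sqrtr // ltW.
exists c, ((Num.sqrt (dotp m m))^-1 *: m), (Num.sqrt K), (Num.sqrt (K / eta)).
split; rewrite ?sqrtr_gt0 ?divr_gt0 //.
  by rewrite dotpZl dotpZr -{3}N2; field.
move=> i t; rewrite /on_hyperboloid onF dotpZl.
have Ke_gt0 : 0 < K / eta by rewrite divr_gt0.
rewrite (sqr_sqrtr (ltW K_gt0)) (sqr_sqrtr (ltW Ke_gt0)).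
rewrite exprMn exprVn N2 /eta; set h := dotp m (_ - c).
have := lt0r_neq0 K_gt0; have := lt0r_neq0 mm_gt0; move: eta_neq0; rewrite /eta.
by move=> ? ? ?; field; apply/and3P; split.
Qed.

End ClosedPolygons.

(** * Homologous images of a line *)

Section HomologousImages.
Variable R : realType.
Implicit Types (a : quadruple R) (l : oline R) (L : 'I_4 -> point R).

Lemma dotp_mulmx n (u v : 'cV[R]_n) : dotp u v = (u^T *m v) 0 0.
Proof. by rewrite mxE; apply: eq_bigr => k _; rewrite mxE. Qed.

Lemma dotp_rot (g : displacement R) u v :
  dotp (rot g *m u) (rot g *m v) = dotp u v.
Proof.
by rewrite !dotp_mulmx trmx_mul -mulmxA (mulmxA (rot g)^T) rot_orth mul1mx.
Qed.

Lemma on_line_image (g : displacement R) l X :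
  on_line (line_image g l) X -> exists t, X = act g (base l + t *: dir l).
Proof. by case=> t ->; exists t; rewrite act_line. Qed.

Lemma act_on_line_image (g : displacement R) l t :
  on_line (line_image g l) (act g (base l + t *: dir l)).
Proof. by exists t; rewrite act_line. Qed.

Section Edges.
Variables (a : quadruple R) (l : oline R) (L : 'I_4 -> point R).
Variables (p q : 'I_4 -> R).
Hypothesis Lp : forall i, L i = act (a i) (base l + p i *: dir l).
Hypothesis Lq : forall i, L i = act (a (i + 1)) (base l + q i *: dir l).

Let D i := rot (a i) *m dir l.
Let e i := p i - q (i - 1).

Lemma image_edge i j : j + 1 = i -> L i - L j = e i *: D i.
Proof.
move=> ji; have -> : e i = p i - q j by rewrite /e -ji addrK.
rewrite Lp (Lq j) ji !act_line /= opprD addrACA subrr add0r.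
by rewrite -scaleNr -scalerDl.
Qed.

Lemma image_edges : [/\ L 0 - L 3%:R = e 0 *: D 0, L 1 - L 0 = e 1 *: D 1,
  L 2%:R - L 1 = e 2%:R *: D 2%:R & L 3%:R - L 2%:R = e 3%:R *: D 3%:R].
Proof. by split; apply: image_edge; apply: val_inj. Qed.

Lemma dirs_norm i : dotp (D i) (D i) = dotp (dir l) (dir l).
Proof. exact: dotp_rot. Qed.

Lemma follows_orientationE i :
  follows_orientation (homologous_images a l) L i = (0 < e i).
Proof.
rewrite /follows_orientation (@image_edge i) ?subrK // dotpZl.
by rewrite (dirs_norm i) pmulr_lgt0 // dotp_gt0 // dir_neq0.
Qed.

(** [hyperboloid_ruling] for the four lines and [alternating_closed_polygon]
    for the edges, rewritten in terms of s = p + q and t = p - q. *)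
Lemma revolution_balanced :
  volume L != 0 ->
  (forall i, follows_orientation (homologous_images a l) L (i + 1) =
             ~~ follows_orientation (homologous_images a l) L i) ->
  on_hyperboloid_of_revolution (homologous_images a l) ->
  balanced (p 0 + q 0) (p 1 + q 1) (p 2%:R + q 2%:R) (p 3%:R + q 3%:R)
           (p 0 - q 0) (p 1 - q 1) (p 2%:R - q 2%:R) (p 3%:R - q 3%:R).
Proof.
move=> skewL alt [c [n [r [s [n1 r0 s0 H]]]]].
have [e0 e1 e2 e3] := image_edges.
have enz := edge_neq0 e0 e1 e2 e3 skewL.
have sgn i : e i * e (i + 1) < 0.
  move: (alt i) (enz i) (enz (i + 1)); rewrite !follows_orientationE.
  case: (ltgtP (e i) 0) => // ?.
    by case: (ltgtP (e (i + 1)) 0) => // ? _ _ _; nra.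
  by case: (ltgtP (e (i + 1)) 0) => // ? _ _ _; nra.
have rul i : dotp n (D i) ^+ 2 * (r ^+ 2 + s ^+ 2) =
    s ^+ 2 * dotp (dir l) (dir l).
  rewrite -(dirs_norm i).
  apply: (@hyperboloid_ruling _ c n (act (a i) (base l))) => // t.
  by apply: (H i); exists t.
have rs : r ^+ 2 + s ^+ 2 != 0 by rewrite lt0r_neq0 // addr_gt0 // exprn_gt0.
have dd0 := lt0r_neq0 (dotp_gt0 (dir_neq0 l)).
have nD0 : dotp n (D 0) != 0.
  apply/eqP => z; have := rul 0; rewrite z expr0n mul0r => /esym/eqP.
  by rewrite mulf_eq0 expf_eq0 (negPf (lt0r_neq0 s0)) (negPf dd0).
have nDi i : dotp n (D i) ^+ 2 = dotp n (D 0) ^+ 2.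
  by apply: (mulIf rs); rewrite !rul.
have s01 : e 0 * e 1 < 0 by have := sgn 0; rewrite add0r.
have s12 : e 1 * e 2%:R < 0.
  by have := sgn 1; rewrite (_ : 1 + 1 = 2%:R) //; apply: val_inj.
have s23 : e 2%:R * e 3%:R < 0.
  by have := sgn 2%:R; rewrite (_ : 2%:R + 1 = 3%:R) //; apply: val_inj.
have := alternating_closed_polygon (dirs_norm 0) (dirs_norm 1) (dirs_norm 2%:R)
  (dirs_norm 3%:R) (dir01_neq0 e0 e1 e2 e3 skewL) s01 s12 s23
  (polygon_closed e0 e1 e2 e3) nD0 (nDi 1) (nDi 2%:R) (nDi 3%:R).
have -> : e 0 = p 0 - q 3%:R.
  by rewrite /e (_ : 0 - 1 = 3%:R) //; apply: val_inj.
have -> : e 1 = p 1 - q 0 by rewrite /e subrr.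
have -> : e 2%:R = p 2%:R - q 1.
  by rewrite /e (_ : 2%:R - 1 = 1) //; apply: val_inj.
have -> : e 3%:R = p 3%:R - q 2%:R.
  by rewrite /e (_ : 3%:R - 1 = 2%:R) //; apply: val_inj.
case=> h.
- by apply: Or31; lra.
- by apply: Or32; lra.
- by apply: Or33; lra.
Qed.

End Edges.

(** Here p = q, so the lengths p_i - p_(i-1) add up to zero. *)
Lemma transversal_on_hyperboloid a l : transversal a l ->
  skew_quadrilateral (homologous_images a l) ->
  on_hyperboloid_of_revolution (homologous_images a l).
Proof.
move=> tl [L [vL ncL]].
have /fin_all_exists [p ap] i :
    exists t, on_relative_axis a i (base l + t *: dir l).
  by have [_ [[t ->] ax]] := tl i; exists t.
have Lp i : L i = act (a i) (base l + p i *: dir l).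
  apply/esym/vL; split; first exact: act_on_line_image.
  by rewrite ap; exact: act_on_line_image.
have Lq i : L i = act (a (i + 1)) (base l + p i *: dir l) by rewrite Lp ap.
have skewL : volume L != 0 by apply/eqP => v; apply/ncL/coplanarP.
have [e0 e1 e2 e3] := image_edges Lp Lq.
have [|c [n [r [s [n1 r0 s0 H]]]]] := @quadrilateral_on_hyperboloid _ L
    (fun i => rot (a i) *m dir l) (fun i => p i - p (i - 1))
    e0 e1 e2 e3 skewL _ (dirs_norm a l).
  have -> : 0 - 1 = 3%:R :> 'I_4 by apply: val_inj.
  have -> : 2%:R - 1 = 1 :> 'I_4 by apply: val_inj.
  have -> : 3%:R - 1 = 2%:R :> 'I_4 by apply: val_inj.
  by rewrite subrr; ring.
exists c, n, r, s; split=> // i X [t ->].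
rewrite (_ : _ + _ = L i + (t - p i) *: (rot (a i) *m dir l)); first exact: H.
by rewrite Lp act_line /= -[RHS]addrA -scalerDl (addrC (p i)) subrK.
Qed.

(** The points of the line on the axes give common points of consecutive
    images; they are the only ones since adjacent edges of a tetrahedron are
    not parallel. *)
Lemma skew_of_volume a l (p : 'I_4 -> R) :
  (forall i, on_relative_axis a i (base l + p i *: dir l)) ->
  volume (fun i => act (a i) (base l + p i *: dir l)) != 0 ->
  skew_quadrilateral (homologous_images a l).
Proof.
move=> ap; set L := (fun i => _) => skewL.
have Lp i : L i = act (a i) (base l + p i *: dir l) by [].
have Lq i : L i = act (a (i + 1)) (base l + p i *: dir l) by rewrite Lp ap.
have [e0 e1 e2 e3] := image_edges Lp Lq.
exists L; split; last by move/coplanarP/eqP; rewrite (negPf skewL).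
move=> i X; split=> [[/on_line_image [s hs] /on_line_image [t ht]] | ->].
  have D0 := @adjacent_dirs _ L (fun i => rot (a i) *m dir l)
    (fun i => p i - p (i - 1)) e0 e1 e2 e3 skewL i.
  have hs' : X - L i = (s - p i) *: (rot (a i) *m dir l).
    by rewrite hs Lp !act_line /= scalerBl opprD addrACA subrr add0r.
  have ht' : X - L i = (t - p i) *: (rot (a (i + 1)) *m dir l).
    by rewrite ht Lq !act_line /= scalerBl opprD addrACA subrr add0r.
  apply/eqP; rewrite -subr_eq0 hs'; apply/eqP.
  have /eqP : (s - p i) *:
      crossp (rot (a i) *m dir l) (rot (a (i + 1)) *m dir l) = 0.
    transitivity (crossp (X - L i) (rot (a (i + 1)) *m dir l)).
      by rewrite hs'; vec_ring.
    by rewrite ht'; vec_ring.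
  by rewrite scaler_eq0 (negPf D0) orbF => /eqP ->; rewrite scale0r.
by split; [rewrite Lp | rewrite Lq]; exact: act_on_line_image.
Qed.

Lemma unobstructed_transversal a l :
  rotation_quadrangle a ->
  let x := moving_rotor a in
  unobstructed (x 0) (x 1) (x 2%:R) (x 3%:R) ->
  unobstructed (x 1) (x 2%:R) (x 3%:R) (x 0) ->
  unobstructed (x 2%:R) (x 3%:R) (x 0) (x 1) ->
  unobstructed (x 3%:R) (x 0) (x 1) (x 2%:R) ->
  properly_oriented_skew_quadrilateral (homologous_images a l) ->
  on_hyperboloid_of_revolution (homologous_images a l) ->
  transversal a l.
Proof.
move=> rq x u0 u1 u2 u3 [L [vL ncL alt]] hyp.
have vLi i := proj2 (vL i (L i)) erefl.
have /fin_all_exists [p Lp] i : exists t, L i = act (a i) (base l + t *: dir l).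
  by have [/on_line_image] := vLi i.
have /fin_all_exists [q Lq] i :
    exists t, L i = act (a (i + 1)) (base l + t *: dir l).
  by have [_ /on_line_image] := vLi i.
have k0 i : rk (x i) != 0.
  by elim/ord4_cases: i;
    [case/andP: u0 | case/andP: u1 | case/andP: u2 | case/andP: u3].
have pure i : dotp (rC (x i)) (rN (x i)) = 0.
  by have /moving_rotation [g /(rotor_of_pure (k0 i))] := rq i.
have sl i : slides (x i) (base l) (dir l) (p i + q i) (p i - q i).
  by apply: moving_slides; rewrite -Lp -Lq.
have skewL : volume L != 0 by apply/eqP => v; apply/ncL/coplanarP.
have [z0 z1 z2 z3] := unobstructed_meets_all u0 u1 u2 u3 (pure 0) (pure 1)
  (pure 2%:R) (pure 3%:R) (dir_neq0 l) (sl 0) (sl 1) (sl 2%:R) (sl 3%:R)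
  (revolution_balanced Lp Lq skewL alt hyp).
have pq i : p i = q i.
  by apply/eqP; rewrite -subr_eq0; apply/eqP; elim/ord4_cases: i.
move=> i; exists (base l + p i *: dir l); split; first by exists (p i).
by rewrite /on_relative_axis -Lp pq -Lq.
Qed.

End HomologousImages.

(** * Polynomials in the coordinates of a quadruple *)

Section Polynomiality.
Variable R : realType.
Implicit Types (F G : quadruple R -> R) (U V W : quadruple R -> 'cV[R]_3).

Definition polynomial_scalar F : Prop :=
  exists f : {mpoly R[4 * (3 * (3 + 1))]}, forall a, f.@[coordinates a] = F a.

Definition polynomial_vector V : Prop :=
  forall k, polynomial_scalar (fun a => V a k 0).

Lemma poly_const (c : R) : polynomial_scalar (fun=> c).
Proof. by exists c%:MP => a; rewrite mevalC. Qed.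

Lemma poly_add F G : polynomial_scalar F -> polynomial_scalar G ->
  polynomial_scalar (fun a => F a + G a).
Proof. by move=> [f hf] [g hg]; exists (f + g) => a; rewrite mevalD hf hg. Qed.

Lemma poly_opp F : polynomial_scalar F -> polynomial_scalar (fun a => - F a).
Proof. by move=> [f hf]; exists (- f) => a; rewrite mevalN hf. Qed.

Lemma poly_mul F G : polynomial_scalar F -> polynomial_scalar G ->
  polynomial_scalar (fun a => F a * G a).
Proof. by move=> [f hf] [g hg]; exists (f * g) => a; rewrite mevalM hf hg. Qed.

Lemma poly_ext F G : F =1 G -> polynomial_scalar G -> polynomial_scalar F.
Proof. by move=> FG [g hg]; exists g => a; rewrite hg FG. Qed.

Lemma poly_sqr F : polynomial_scalar F -> polynomial_scalar (fun a => F a ^+ 2).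
Proof. by move=> hF; apply: poly_mul. Qed.

Lemma poly_rot i j k : polynomial_scalar (fun a => rot (a i) j k).
Proof.
exists 'X_(mxvec_index i (mxvec_index j (lshift 1 k))) => a.
by rewrite mevalXU /coordinates mxvecE mxE mxvecE row_mxEl.
Qed.

Lemma poly_trans i : polynomial_vector (fun a => trans (a i)).
Proof.
move=> j; exists 'X_(mxvec_index i (mxvec_index j (rshift 3 0))) => a.
by rewrite mevalXU /coordinates mxvecE mxE mxvecE row_mxEr.
Qed.

Lemma poly_vec_add U V : polynomial_vector U -> polynomial_vector V ->
  polynomial_vector (fun a => U a + V a).
Proof.
move=> hU hV k; apply: poly_ext (poly_add (hU k) (hV k)) => a; exact: addvE.
Qed.

Lemma poly_vec_opp U : polynomial_vector U ->
  polynomial_vector (fun a => - U a).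
Proof. move=> hU k; apply: poly_ext (poly_opp (hU k)) => a; exact: oppvE. Qed.

Lemma poly_vec_scale F U : polynomial_scalar F -> polynomial_vector U ->
  polynomial_vector (fun a => F a *: U a).
Proof.
by move=> hF hU k; apply: poly_ext (poly_mul hF (hU k)) => a; exact: scalevE.
Qed.

Lemma poly_dotp U V : polynomial_vector U -> polynomial_vector V ->
  polynomial_scalar (fun a => dotp (U a) (V a)).
Proof.
move=> hU hV; apply: poly_ext (fun a => dotpE (U a) (V a)) _.
by do ?apply: poly_add; apply: poly_mul.
Qed.

Lemma poly_crossp U V : polynomial_vector U -> polynomial_vector V ->
  polynomial_vector (fun a => crossp (U a) (V a)).
Proof.
move=> hU hV k; apply: (@poly_ext _ (fun a => U a (k + 1) 0 * V a (k + 2%:R) 0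
  - U a (k + 2%:R) 0 * V a (k + 1) 0)); first by move=> a; rewrite mxE.
by apply: poly_add; [| apply: poly_opp]; apply: poly_mul.
Qed.

Lemma poly_pencil U U' V V' W W' :
  polynomial_vector U -> polynomial_vector U' -> polynomial_vector V ->
  polynomial_vector V' -> polynomial_vector W -> polynomial_vector W' ->
  polynomial_scalar
    (fun a => pencil_resultant (U a) (U' a) (V a) (V' a) (W a) (W' a)).
Proof.
move=> hU hU' hV hV' hW hW'; rewrite /pencil_resultant /resultant2.
by repeat first [assumption | apply: poly_add | apply: poly_opp
  | apply: poly_sqr | apply: poly_mul | apply: poly_dotp].
Qed.

End Polynomiality.

Ltac polynomial :=
  repeat first
    [ assumption | exact: poly_const
    | apply: poly_dotp | apply: poly_vec_add | apply: poly_vec_opp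
    | apply: poly_crossp | apply: poly_vec_scale
    | apply: poly_add | apply: poly_opp | apply: poly_sqr | apply: poly_mul ].

Section RotorPolynomials.
Variable R : realType.
Implicit Types (X Y Z W : quadruple R -> rotor R).

Definition polynomial_rotor X : Prop :=
  [/\ polynomial_scalar (fun a => rk (X a)),
      polynomial_vector (fun a => rC (X a)) &
      polynomial_vector (fun a => rN (X a))].

Lemma poly_foot X Y Z W : polynomial_rotor X -> polynomial_rotor Y ->
  polynomial_rotor Z -> polynomial_rotor W ->
  polynomial_scalar (fun a => foot_resultant (X a) (Y a) (Z a) (W a)).
Proof.
move=> [? ? ?] [? ? ?] [? ? ?] [? ? ?].
by apply: poly_pencil; polynomial.
Qed.

Lemma poly_slide X Y Z W : polynomial_rotor X -> polynomial_rotor Y ->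
  polynomial_rotor Z -> polynomial_rotor W ->
  polynomial_scalar (fun a => slide_resultant (X a) (Y a) (Z a) (W a)).
Proof.
move=> [? ? ?] [? ? ?] [? ? ?] [? ? ?].
by apply: poly_pencil; polynomial.
Qed.

Lemma poly_pair X Y Z W a_m a_n a_x a_y b_x b_y :
  polynomial_rotor X -> polynomial_rotor Y ->
  polynomial_rotor Z -> polynomial_rotor W ->
  polynomial_scalar
    (fun a => pair_obstruction (X a) (Y a) (Z a) (W a) a_m a_n a_x a_y b_x b_y).
Proof.
move=> [? ? ?] [? ? ?] [? ? ?] [? ? ?].
rewrite /pair_obstruction /pair_form /scaled_mid /scaled_shift.
rewrite /join_base /join_det.
by polynomial.
Qed.

Lemma poly_obstruction X Y Z W : polynomial_rotor X -> polynomial_rotor Y ->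
  polynomial_rotor Z -> polynomial_rotor W ->
  polynomial_scalar
    (fun a => \prod_(c <- obstruction_at (X a) (Y a) (Z a) (W a)) c).
Proof.
move=> hX hY hZ hW.
apply: poly_ext; first by move=> a; rewrite !big_cons big_nil.
have [? ? ?] := hX; have [? ? ?] := hY; have [? ? ?] := hZ.
by repeat first [apply: poly_foot | apply: poly_slide | apply: poly_pair
  | apply: poly_mul | polynomial].
Qed.

Lemma poly_moving_rot i j k :
  polynomial_scalar (fun a : quadruple R => rot (moving_displacement a i) j k).
Proof.
apply: poly_ext; first by move=> a; rewrite /= mxE sum3E !mxE.
by polynomial; apply: poly_rot.
Qed.

Lemma poly_moving_rotor i : polynomial_rotor (fun a => moving_rotor a i).
Proof.
have M := poly_moving_rot i.
have k : polynomial_scalar (fun a : quadruple R => rk (moving_rotor a i)).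
  apply: poly_ext; first by move=> a; rewrite /= trace3E.
  by polynomial; apply: M.
have C : polynomial_vector (fun a : quadruple R => rC (moving_rotor a i)).
  move=> j; apply: poly_ext; first by move=> a; rewrite mxE.
  by polynomial; apply: M.
have T : polynomial_vector
    (fun a : quadruple R => trans (moving_displacement a i)).
  have mulT (V : quadruple R -> 'cV[R]_3) : polynomial_vector V ->
      polynomial_vector (fun a => (rot (a i))^T *m V a).
    move=> hV j; apply: poly_ext; first by move=> a; rewrite mulmx3E !mxE.
    by polynomial; first [apply: poly_rot | apply: hV].
  by apply: poly_vec_add; [|apply: poly_vec_opp]; apply: mulT;
    exact: poly_trans.
split=> //; apply: poly_vec_scale; first exact: poly_const.
by polynomial.
Qed.

End RotorPolynomials.

(** * Rational vectors and matrices *)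

Delimit Scope Q_scope with BinQ.
Delimit Scope Z_scope with BinZ.

Definition of_Z {R : realType} (n : Z) : R := (int_of_Z n)%:~R.

(** The canonical map from the rational numbers in binary notation.  It is
    locked, as are vectors over it: unfolding would lead to unary numerals. *)
HB.lock Definition of_Q {R : realType} (x : Q) : R :=
  of_Z (Qnum x) / of_Z (Zpos (Qden x)).

HB.lock Definition vec_of_Q {R : realType} (x : Q * Q * Q) : 'cV[R]_3 :=
  \col_k nth 0 [:: of_Q x.1.1; of_Q x.1.2; of_Q x.2] k.

Section RationalVectors.
Variable R : realType.
Local Notation of_Z := (@of_Z R).
Local Notation of_Q := (@of_Q R).
Local Notation vec_of_Q := (@vec_of_Q R).

Lemma of_ZM n m : of_Z (Z.mul n m) = of_Z n * of_Z m.
Proof. by rewrite /of_Z -intrM -rmorphM. Qed.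

Lemma of_ZD n m : of_Z (Z.add n m) = of_Z n + of_Z m.
Proof. by rewrite /of_Z -intrD -rmorphD. Qed.

Lemma of_ZN n : of_Z (Z.opp n) = - of_Z n.
Proof. by rewrite /of_Z -intrN -rmorphN. Qed.

Lemma of_Z_eq0 n : (of_Z n == 0) = (n == Z0).
Proof. by rewrite intr_eq0 -(rmorph0 int_of_Z) (can_eq int_of_ZK). Qed.

Lemma of_Zpos_neq0 d : of_Z (Zpos d) != 0.
Proof. by rewrite of_Z_eq0. Qed.

Lemma of_Q_neq0 x : Qnum x != Z0 -> of_Q x != 0.
Proof.
by move=> x0; rewrite unlock mulf_neq0 ?invr_neq0 ?of_Zpos_neq0 // of_Z_eq0.
Qed.

Lemma of_Q_red x : of_Q (Qred x) = of_Q x.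
Proof.
have := Qred_correct x; rewrite /Qeq.
move/(congr1 of_Z); rewrite !of_ZM => e; rewrite !unlock.
by apply/eqP; rewrite eqr_div ?of_Zpos_neq0 // e.
Qed.

Lemma of_QM x y : of_Q x * of_Q y = of_Q (Qred (Qmult x y)).
Proof.
rewrite of_Q_red; case: x y => [n d] [n' d']; rewrite !unlock.
rewrite -[Zpos (Qden (Qmult _ _))]/(Z.mul (Zpos d) (Zpos d')).
by rewrite !of_ZM invfM mulrACA.
Qed.

Lemma of_QD x y : of_Q x + of_Q y = of_Q (Qred (Qplus x y)).
Proof.
rewrite of_Q_red; case: x y => [n d] [n' d']; rewrite !unlock.
rewrite -[Zpos (Qden (Qplus _ _))]/(Z.mul (Zpos d) (Zpos d')).
by rewrite of_ZD !of_ZM -addf_div ?of_Zpos_neq0.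
Qed.

Lemma of_QN x : - of_Q x = of_Q (Qopp x).
Proof. by rewrite unlock of_ZN mulNr. Qed.

Lemma vec_of_Q_0 x : vec_of_Q x 0 0 = of_Q x.1.1.
Proof. by rewrite unlock mxE. Qed.
Lemma vec_of_Q_1 x : vec_of_Q x 1 0 = of_Q x.1.2.
Proof. by rewrite unlock mxE. Qed.
Lemma vec_of_Q_2 x : vec_of_Q x 2%:R 0 = of_Q x.2.
Proof. by rewrite unlock mxE. Qed.

Definition vec_of_QE := (vec_of_Q_0, vec_of_Q_1, vec_of_Q_2).
Definition of_QE := (of_QM, of_QN, of_QD).

Let qm x y := Qred (Qmult x y).
Let qa x y := Qred (Qplus x y).
Let qo := Qopp.

Definition qdot (x y : Q * Q * Q) : Q :=
  qa (qa (qm x.1.1 y.1.1) (qm x.1.2 y.1.2)) (qm x.2 y.2).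
Definition qcross (x y : Q * Q * Q) : Q * Q * Q :=
  (qa (qm x.1.2 y.2) (qo (qm x.2 y.1.2)), qa (qm x.2 y.1.1) (qo (qm x.1.1 y.2)),
   qa (qm x.1.1 y.1.2) (qo (qm x.1.2 y.1.1))).
Definition qscale (c : Q) (x : Q * Q * Q) : Q * Q * Q :=
  (qm c x.1.1, qm c x.1.2, qm c x.2).
Definition qadd (x y : Q * Q * Q) : Q * Q * Q :=
  (qa x.1.1 y.1.1, qa x.1.2 y.1.2, qa x.2 y.2).
Definition qopp (x : Q * Q * Q) : Q * Q * Q := (qo x.1.1, qo x.1.2, qo x.2).

Lemma qdotE x y : dotp (vec_of_Q x) (vec_of_Q y) = of_Q (qdot x y).
Proof. by rewrite vecE !vec_of_QE !of_QE. Qed.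
Lemma qcrossE x y : crossp (vec_of_Q x) (vec_of_Q y) = vec_of_Q (qcross x y).
Proof. by apply: colP3; rewrite vecE !vec_of_QE !of_QE. Qed.
Lemma qscaleE c x : of_Q c *: vec_of_Q x = vec_of_Q (qscale c x).
Proof. by apply: colP3; rewrite vecE !vec_of_QE !of_QE. Qed.
Lemma qaddE x y : vec_of_Q x + vec_of_Q y = vec_of_Q (qadd x y).
Proof. by apply: colP3; rewrite vecE !vec_of_QE !of_QE. Qed.
Lemma qoppE x : - vec_of_Q x = vec_of_Q (qopp x).
Proof. by apply: colP3; rewrite vecE !vec_of_QE !of_QE. Qed.

Definition qvecE := (qdotE, qcrossE, qscaleE, qaddE, qoppE, of_QE).

Definition mat_of_Q (r0 r1 r2 : Q * Q * Q) : 'M[R]_3 :=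
  \matrix_(i, j) vec_of_Q (nth r0 [:: r0; r1; r2] i) j 0.

Lemma mat_of_Q_0 r0 r1 r2 j : mat_of_Q r0 r1 r2 0 j = vec_of_Q r0 j 0.
Proof. by rewrite mxE. Qed.
Lemma mat_of_Q_1 r0 r1 r2 j : mat_of_Q r0 r1 r2 1 j = vec_of_Q r1 j 0.
Proof. by rewrite mxE. Qed.
Lemma mat_of_Q_2 r0 r1 r2 j : mat_of_Q r0 r1 r2 2%:R j = vec_of_Q r2 j 0.
Proof. by rewrite mxE. Qed.

Definition mat_of_QE := (mat_of_Q_0, mat_of_Q_1, mat_of_Q_2, vec_of_QE).

Lemma of_Q0 : of_Q (0 # 1)%BinQ = 0.
Proof. by rewrite unlock /of_Z /= mul0r. Qed.

Lemma of_Q1 : of_Q (1 # 1)%BinQ = 1.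
Proof. by rewrite unlock /of_Z /= divr1. Qed.

Lemma qmat_mulE r0 r1 r2 x : mat_of_Q r0 r1 r2 *m vec_of_Q x =
  vec_of_Q (qdot r0 x, qdot r1 x, qdot r2 x).
Proof. by apply: colP3; rewrite mulmx3E !mat_of_QE /= !of_QE. Qed.

End RationalVectors.

Arguments mat_of_Q {R} r0 r1 r2.

Ltac q_norm :=
  repeat match goal with
  | |- context [@of_Q ?R ?q] =>
    lazymatch q with
    | Qmake _ _ => fail
    | _ => let v := eval vm_compute in q in change (@of_Q R q) with (@of_Q R v)
    end
  | |- context [@vec_of_Q ?R ?q] =>
    lazymatch q with
    | (Qmake _ _, Qmake _ _, Qmake _ _) => fail
    | _ => let v := eval vm_compute in q in
           change (@vec_of_Q R q) with (@vec_of_Q R v)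
    end
  end.

(** Evaluates closed expressions from the inside: each step replaces one
    operation on images of rationals by the image of a reduced rational. *)
Ltac q_eval := q_norm; repeat (rewrite qvecE; q_norm).

(** * A rational rotation quadrangle *)

Local Notation qv x y z := (x%BinQ, y%BinQ, z%BinQ).

(** Turns images of rationals into fractions of integer numerals. *)
Ltac of_Q_numerals := rewrite ?unlock /of_Z /= /Pos.to_nat /=.

Section Example.
Variable R : realType.

Definition thirds (x y z : Z) : Q * Q * Q :=
  (Qmake x 3%positive, Qmake y 3%positive, Qmake z 3%positive).
Definition ints (x y z : Z) : Q * Q * Q :=
  (Qmake x 1%positive, Qmake y 1%positive, Qmake z 1%positive).
Arguments thirds (x y z)%_BinZ.
Arguments ints (x y z)%_BinZ.

Lemma mat_of_Q_SO3 (M := @mat_of_Q R) r0 r1 r2 :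
  [/\ qdot r0 r0 = 1%BinQ, qdot r1 r1 = 1%BinQ &
      qdot r2 r2 = 1%BinQ] ->
  [/\ qdot r0 r1 = 0%BinQ, qdot r0 r2 = 0%BinQ &
      qdot r1 r2 = 0%BinQ] ->
  qdot r0 (qcross r1 r2) = 1%BinQ ->
  ((M r0 r1 r2)^T *m M r0 r1 r2 == 1%:M) && (\det (M r0 r1 r2) == 1).
Proof.
move=> [h00 h11 h22] [h01 h02 h12] hd.
pose v := @vec_of_Q R.
have MM i j : (M r0 r1 r2 *m (M r0 r1 r2)^T) i j =
    dotp (v (nth r0 [:: r0; r1; r2] i)) (v (nth r0 [:: r0; r1; r2] j)).
  by rewrite mxE; apply: eq_bigr => k _; rewrite !mxE.
apply/andP; split; apply/eqP.
  apply: mulmx1C; apply/matrixP => i j; rewrite MM [RHS]mxE.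
  have e00 : dotp (v r0) (v r0) = 1 by rewrite qdotE h00 of_Q1.
  have e11 : dotp (v r1) (v r1) = 1 by rewrite qdotE h11 of_Q1.
  have e22 : dotp (v r2) (v r2) = 1 by rewrite qdotE h22 of_Q1.
  have e01 : dotp (v r0) (v r1) = 0 by rewrite qdotE h01 of_Q0.
  have e02 : dotp (v r0) (v r2) = 0 by rewrite qdotE h02 of_Q0.
  have e12 : dotp (v r1) (v r2) = 0 by rewrite qdotE h12 of_Q0.
  move: i j; elim/ord3_cases; elim/ord3_cases;
  by rewrite ?e00 ?e01 ?e02 ?e11 ?e12 ?e22 // dotpC ?e01 ?e02 ?e12.
transitivity (dotp (v r0) (crossp (v r1) (v r2))); last first.
  by rewrite qcrossE qdotE hd of_Q1.
by rewrite det3E !mat_of_QE !vecE /v !vec_of_QE; ring.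
Qed.

Definition pose0 : displacement R := Displacement (vec_of_Q (ints 0 0 0))
  (@mat_of_Q_SO3 (ints 1 0 0) (ints 0 1 0) (ints 0 0 1)
    (And3 erefl erefl erefl) (And3 erefl erefl erefl) erefl).
Definition pose1 : displacement R := Displacement (vec_of_Q (ints 0 0 (-1)))
  (@mat_of_Q_SO3 (thirds 1 2 (-2)) (thirds 2 1 2) (thirds 2 (-2) (-1))
    (And3 erefl erefl erefl) (And3 erefl erefl erefl) erefl).
Definition pose2 : displacement R := Displacement (vec_of_Q (ints 0 1 2))
  (@mat_of_Q_SO3 (ints 0 (-1) 0) (ints 0 0 1) (ints (-1) 0 0)
    (And3 erefl erefl erefl) (And3 erefl erefl erefl) erefl).
Definition pose3 : displacement R := Displacement (vec_of_Q (ints 0 0 0))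
  (@mat_of_Q_SO3 (thirds 2 2 (-1)) (thirds 2 (-1) 2) (thirds 1 (-2) (-2))
    (And3 erefl erefl erefl) (And3 erefl erefl erefl) erefl).

(** The rotations were chosen with k > 0, rational entries and independent axis
    directions, the translations such that consecutive relative displacements
    are rotations and the quadratic equation for the transversals splits over
    the rationals. *)
Definition example : quadruple R :=
  fun i => nth pose0 [:: pose0; pose1; pose2; pose3] i.

Definition rotor_of_Q (k : Q) (C N : Q * Q * Q) : rotor R :=
  Rotor (of_Q k) (vec_of_Q C) (vec_of_Q N).

Definition qaxial (r0 r1 r2 : Q * Q * Q) : Q * Q * Q :=
  let d x y := Qred (Qplus x (Qopp y)) in
  (d r2.1.2 r1.2, d r0.2 r2.1.1, d r1.1.1 r0.1.2).

Lemma axial_of_Q r0 r1 r2 :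
  axial (mat_of_Q r0 r1 r2) = vec_of_Q (qaxial r0 r1 r2) :> 'cV[R]_3.
Proof. by apply: colP3; rewrite ?matE !mat_of_QE !of_QE. Qed.

Definition qcols (r0 r1 r2 : Q * Q * Q) :
    (Q * Q * Q) * (Q * Q * Q) * (Q * Q * Q) :=
  ((r0.1.1, r1.1.1, r2.1.1), (r0.1.2, r1.1.2, r2.1.2), (r0.2, r1.2, r2.2)).

Lemma tr_of_Q r0 r1 r2 : (mat_of_Q r0 r1 r2)^T =
  let c := qcols r0 r1 r2 in mat_of_Q c.1.1 c.1.2 c.2 :> 'M[R]_3.
Proof.
apply/matrixP => i j; rewrite mxE; move: i j.
by elim/ord3_cases; elim/ord3_cases; rewrite !mat_of_QE.
Qed.

Lemma mul_of_Q r0 r1 r2 s0 s1 s2 : mat_of_Q r0 r1 r2 *m mat_of_Q s0 s1 s2 =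
  let c := qcols s0 s1 s2 in
  let row r := (qdot r c.1.1, qdot r c.1.2, qdot r c.2) in
  mat_of_Q (row r0) (row r1) (row r2) :> 'M[R]_3.
Proof.
apply/matrixP => i j; rewrite mxE sum3E; move: i j.
by elim/ord3_cases; elim/ord3_cases; rewrite !mat_of_QE !of_QE.
Qed.

Lemma trace1_of_Q r0 r1 r2 : 1 + \tr (mat_of_Q r0 r1 r2) =
  of_Q (Qred (Qplus 1%BinQ (qdot (ints 1 1 1) (r0.1.1, r1.1.2, r2.2))))
  :> R.
Proof.
rewrite trace3E !mat_of_QE -of_QD of_Q1 -qdotE !vecE !vec_of_QE /= /ints.
by rewrite of_Q1 !mul1r.
Qed.

Lemma half_of_Q : 2^-1 = of_Q (1 # 2)%BinQ :> R.
Proof. by rewrite unlock /of_Z /= mul1r. Qed.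

Definition example_rotor (i : 'I_4) : rotor R :=
  nth (Rotor 0 0 0)
  [:: rotor_of_Q (4 # 3)%BinQ (qv (-4 # 3) (-4 # 3) 0)
                 (qv (-2 # 3) (2 # 3) (-2 # 3));
      rotor_of_Q (1 # 3)%BinQ (qv (1 # 3) (1 # 3) 1)
                 (qv (-1 # 3) (-5 # 3) (2 # 3));
      rotor_of_Q (2 # 3)%BinQ (qv (-2 # 3) 0 (-4 # 3))
                 (qv (2 # 3) (5 # 3) (-1 # 3));
      rotor_of_Q (2 # 3)%BinQ (qv (4 # 3) (2 # 3) 0)
                 (qv 0 0 0)] i.

Lemma example_rotorE i : moving_rotor example i = example_rotor i.
Proof.
have ev (g h : displacement R) :
    rotor_of (disp_comp (disp_inv g) h) =
    let M := (rot g)^T *m rot h in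
    let T := (rot g)^T *m trans h + - ((rot g)^T *m trans g) in
    Rotor (1 + \tr M) (axial M)
      (2^-1 *: ((1 + \tr M) *: T - crossp (axial M) T)) by [].
move: i; elim/ord4_cases; rewrite /moving_rotor /moving_displacement ev.
all: rewrite /example /= tr_of_Q mul_of_Q trace1_of_Q axial_of_Q.
all: rewrite !qmat_mulE half_of_Q.
all: by q_eval.
Qed.

Lemma example_unobstructed :
  [/\ unobstructed (example_rotor 0) (example_rotor 1)
        (example_rotor 2%:R) (example_rotor 3%:R),
      unobstructed (example_rotor 1) (example_rotor 2%:R)
        (example_rotor 3%:R) (example_rotor 0),
      unobstructed (example_rotor 2%:R) (example_rotor 3%:R)
        (example_rotor 0) (example_rotor 1) &
      unobstructed (example_rotor 3%:R) (example_rotor 0)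
        (example_rotor 1) (example_rotor 2%:R)].
Proof.
split; rewrite /unobstructed /obstruction_at /example_rotor /=.
all: rewrite andbT; repeat (apply/andP; split).
all: rewrite /slide_resultant /foot_resultant /pair_obstruction /pair_form
  /scaled_mid /scaled_shift /join_base /join_det /=.
all: rewrite ?(mul0r, mul1r, mulN1r, add0r, addr0, oppr0).
all: q_eval; rewrite /pencil_resultant /resultant2 ?expr2; q_eval.
all: by apply: of_Q_neq0; vm_compute.
Qed.

Lemma example_k_neq0 i : rk (example_rotor i) != 0.
Proof. by elim/ord4_cases: i; apply: of_Q_neq0. Qed.

Lemma vec_of_Q_neq0 x : Qnum (qdot x x) != Z0 -> vec_of_Q x != 0 :> 'cV[R]_3.
Proof.
move=> x0; have := @of_Q_neq0 R _ x0; rewrite -qdotE; apply: contra => /eqP ->.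
by apply/eqP; vec_ring.
Qed.

Lemma example_rotation_quadrangle : rotation_quadrangle example.
Proof.
move=> i; apply/moving_rotation; apply: rotation_of_pure;
  rewrite -/(moving_rotor example i) example_rotorE.
- exact: example_k_neq0.
- by elim/ord4_cases: i; apply: vec_of_Q_neq0.
- by elim/ord4_cases: i; rewrite /example_rotor /=; q_eval; rewrite of_Q0.
Qed.

Definition line_u : oline R :=
  @OLine R (vec_of_Q (qv (1 # 2) 0 (-1 # 2)))
    (vec_of_Q (ints 0 1 2)) (@vec_of_Q_neq0 (ints 0 1 2) isT).

Definition line_v : oline R :=
  @OLine R (vec_of_Q (ints 2 1 0)) (vec_of_Q (ints 0 1 (-1)))
    (@vec_of_Q_neq0 (ints 0 1 (-1)) isT).

(** Parameters of the points where the transversal meets the axes. *)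
Definition param_u (i : 'I_4) : Q :=
  nth 0%BinQ [:: 0%BinQ; (-3 # 2)%BinQ; (-1 # 2)%BinQ; (1 # 4)%BinQ] i.

Definition param_v (i : 'I_4) : Q :=
  nth 0%BinQ [:: (1 # 2)%BinQ; (-1)%BinQ; (-3 # 2)%BinQ; 0%BinQ] i.

Lemma example_axis_u i :
  on_relative_axis example i (base line_u + of_Q (param_u i) *: dir line_u).
Proof.
apply/on_relative_axisE; rewrite example_rotorE; first exact: example_k_neq0.
by elim/ord4_cases: i; rewrite /example_rotor /param_u /=; q_eval.
Qed.

Lemma example_axis_v i :
  on_relative_axis example i (base line_v + of_Q (param_v i) *: dir line_v).
Proof.
apply/on_relative_axisE; rewrite example_rotorE; first exact: example_k_neq0.
by elim/ord4_cases: i; rewrite /example_rotor /param_v /=; q_eval.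
Qed.

Lemma example_skew_u : skew_quadrilateral (homologous_images example line_u).
Proof.
apply: skew_of_volume example_axis_u _.
rewrite /volume /act /example /param_u /=; q_eval; rewrite ?qmat_mulE; q_eval.
by apply: of_Q_neq0; vm_compute.
Qed.

Lemma example_skew_v : skew_quadrilateral (homologous_images example line_v).
Proof.
apply: skew_of_volume example_axis_v _.
rewrite /volume /act /example /param_v /=; q_eval; rewrite ?qmat_mulE; q_eval.
by apply: of_Q_neq0; vm_compute.
Qed.

Lemma same_line_pluecker (l m : oline R) (c : R) : dir l = c *: dir m ->
  crossp (base l) (dir l) = c *: crossp (base m) (dir m) -> same_line l m.
Proof.
move=> dlm blm.
have c0 : c != 0.
  by apply: contraNneq (dir_neq0 l) => c0; rewrite dlm c0 scale0r.
have mm := lt0r_neq0 (dotp_gt0 (dir_neq0 m)).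
have par : crossp (base l - base m) (dir m) = 0.
  apply: (scalerI c0).
  transitivity (crossp (base l) (c *: dir m) - c *: crossp (base m) (dir m)).
    by vec_ring.
  by rewrite -dlm blm subrr scaler0.
pose s := dotp (dir m) (base l - base m) / dotp (dir m) (dir m).
have bE : base l = base m + s *: dir m.
  apply/eqP; rewrite addrC -subr_eq; apply/eqP/(scalerI mm).
  rewrite scalerA /s mulrC divfK //.
  transitivity (dotp (dir m) (base l - base m) *: dir m
    - crossp (crossp (base l - base m) (dir m)) (dir m)); first by vec_ring.
  by rewrite par; vec_ring.
move=> X; split=> [[t ->] | [t ->]].
  by exists (s + t * c); rewrite bE dlm; vec_ring.
exists ((t - s) / c); rewrite bE dlm scalerA divfK //.
by vec_ring.
Qed.

Lemma example_not_same : ~ same_line line_u line_v.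
Proof.
move=> /(_ (base line_u)) [h _].
have /h[t /(congr1 (fun u : 'cV[R]_3 => u 0 0))] : on_line line_u (base line_u).
  by exists 0; rewrite scale0r addr0.
rewrite !vecE !vec_of_QE /=; of_Q_numerals; lra.
Qed.

(** The Pluecker coordinates (d, m) of a transversal satisfy four linear
    equations; on their solutions the relation d . m = 0 is, up to a
    factor, (d2 - 2 d1) (d2 + d1) = 0. *)
Lemma example_pluecker (d0 d1 d2 m0 m1 m2 : R) :
  - d0 + d1 - d2 - 2 * m0 - 2 * m1 = 0 ->
  - d0 - 5 * d1 + 2 * d2 + m0 + m1 + 3 * m2 = 0 ->
  2 * d0 + 5 * d1 - d2 - 2 * m0 - 4 * m2 = 0 ->
  2 * m0 + m1 = 0 ->
  d0 * m0 + d1 * m1 + d2 * m2 = 0 ->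
  [/\ d0 = 0, m0 = (d2 - d1) / 2, m1 = d1 - d2, m2 = (3 * d1 - d2) / 2 &
      d2 = 2 * d1 \/ d2 = - d1].
Proof.
move=> h0 h1 h2 h3 dm.
have e0 : d0 = 0 by lra.
have f0 : m0 = (d2 - d1) / 2 by lra.
have f1 : m1 = d1 - d2 by lra.
have f2 : m2 = (3 * d1 - d2) / 2 by lra.
split=> //.
have /eqP : (d2 - 2 * d1) * (d2 + d1) = 0.
  by rewrite -[RHS](mulr0 (-2)) -dm e0 f0 f1 f2; field.
by rewrite mulf_eq0 => /orP[] /eqP ?; [left | right]; lra.
Qed.

Lemma example_transversals (l : oline R) : transversal example l ->
  same_line l line_u \/ same_line l line_v.
Proof.
move=> tl.
have [m mE] : exists m, m = crossp (base l) (dir l) by eexists.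
have rec i :
    dotp (rN (example_rotor i)) (dir l) + dotp (rC (example_rotor i)) m = 0.
  have [_ [[t ->]]] := tl i.
  rewrite on_relative_axisE example_rotorE; last exact: example_k_neq0.
  by move=> ->; rewrite mE; vec_ring.
have dm : dotp (dir l) m = 0 by rewrite mE; vec_ring.
have [] := @example_pluecker (dir l 0 0) (dir l 1 0) (dir l 2%:R 0)
  (m 0 0) (m 1 0) (m 2%:R 0).
all: try by move: dm; rewrite !vecE.
1: move: (rec 0). 2: move: (rec 1). 3: move: (rec 2%:R). 4: move: (rec 3%:R).
1-4: rewrite /example_rotor /= !vecE !vec_of_QE /=; of_Q_numerals.
1-4: by clear; lra.
move=> d0 m0 m1 m2 [d2 | d2]; [left | right];
  apply: (same_line_pluecker (c := dir l 1 0)); rewrite -?mE;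
  apply: colP3; rewrite /= !vecE !vec_of_QE /=; of_Q_numerals;
  rewrite ?d0 ?m0 ?m1 ?m2 ?d2; by clear; field.
Qed.

Lemma example_two_transversals : the_two_transversals example line_u line_v.
Proof.
split; [| | exact: example_not_same | exact: example_transversals].
- by move=> i; exists (base line_u + of_Q (param_u i) *: dir line_u);
    split; [eexists | exact: example_axis_u].
- by move=> i; exists (base line_v + of_Q (param_v i) *: dir line_v);
    split; [eexists | exact: example_axis_v].
Qed.


Section StudyImages.

Lemma mkquatK_re s v : qre (mkquat s v) = s :> R.
Proof. by rewrite /qre /mkquat row_mxKl mxE eqxx. Qed.

Lemma mkquatK_im s v : qim (mkquat s v) = v :> 'cV[R]_3.
Proof. by rewrite /qim /mkquat row_mxKr trmxK. Qed.

Lemma mkquatD s v s' v' :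
  mkquat s v + mkquat s' v' = mkquat (s + s') (v + v') :> quat R.
Proof. by rewrite /mkquat add_row_mx -raddfD -raddfD. Qed.

Lemma mkquatZ c s v : c *: mkquat s v = mkquat (c * s) (c *: v) :> quat R.
Proof. by rewrite /mkquat scale_row_mx scale_scalar_mx -linearZ. Qed.

Lemma sum_quat (x y : quat R) :
  \sum_k x 0 k * y 0 k = qre x * qre y + dotp (qim x) (qim y).
Proof.
rewrite big_split_ord /= big_ord1 /qre !mxE; congr (_ * _ + _).
by apply: eq_bigr => k _; rewrite !mxE.
Qed.

Lemma mkquatN s v : - mkquat s v = mkquat (- s) (- v) :> quat R.
Proof. by rewrite -scaleN1r mkquatZ mulN1r scaleN1r. Qed.

(** The right-hand side is x X conj(x) for the quaternion x = k + C.  The image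
    Y of X satisfies k Y - C x Y = W with W = k X + C x X, and this is solved
    by (k^2 + |C|^2) Y = k W + C x W + (C . Y) C, where C . Y = C . X. *)
Lemma rot_rotor (g : displacement R) (X : 'cV[R]_3) :
  rk (rotor_of g) != 0 ->
  let k := rk (rotor_of g) in let C := rC (rotor_of g) in
  (k ^+ 2 + dotp C C) *: (rot g *m X) =
  (k ^+ 2 - dotp C C) *: X + (2 * dotp C X) *: C + (2 * k) *: crossp C X.
Proof.
move=> k0 k C.
have := rotor_ofP g 0; have := rotor_ofP g X.
rewrite /act mulmx0 add0r -/k -/C; set N := rN _; set T := trans g => hX h0.
set Y := rot g *m X in hX *.
have e : k *: Y - crossp C Y = k *: X + crossp C X.
  apply/eqP; rewrite -subr_eq0; apply/eqP.
  transitivity (k *: (Y + T - X) - crossp C (Y + T + X)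
    - (k *: (T - 0) - crossp C (T + 0))); first by vec_ring.
  by rewrite hX h0; vec_ring.
have CY : dotp C Y = dotp C X.
  apply: (mulfI k0); rewrite -/k.
  transitivity (dotp C (k *: Y - crossp C Y)); first by vec_ring.
  by rewrite e; vec_ring.
transitivity (k *: (k *: Y - crossp C Y) + crossp C (k *: Y - crossp C Y)
  + dotp C Y *: C); first by vec_ring.
by rewrite e CY; vec_ring.
Qed.

(** The dual quaternion x + eps y with x = k + C and y = T x / 2 for the
    translation vector T. *)
Definition study_point (g : displacement R) : study_coords R :=
  let k := rk (rotor_of g) in
  let C := rC (rotor_of g) in
  row_mx (mkquat k C) (mkquat (- (2^-1 * dotp (trans g) C))
    (2^-1 *: (k *: trans g + crossp (trans g) C))).

Lemma lsubmx_study_point (c : R) g : lsubmx (c *: study_point g) =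
  mkquat (c * rk (rotor_of g)) (c *: rC (rotor_of g)).
Proof. by rewrite linearZ /= row_mxKl mkquatZ. Qed.

Lemma study_form_mkquat s v s' v' :
  study_form (row_mx (mkquat s v) (mkquat s' v')) = s * s' + dotp v v' :> R.
Proof.
by rewrite /study_form row_mxKl row_mxKr sum_quat !mkquatK_re !mkquatK_im.
Qed.

Lemma study_image_point (g : displacement R) : rk (rotor_of g) != 0 ->
  study_image g (study_point g).
Proof.
move=> k0; have hrot X := rot_rotor X k0; cbv zeta in hrot.
rewrite /study_image /study_point.
set k := rk _ in k0 hrot *; set C := rC _ in hrot *.
rewrite row_mxKl row_mxKr; split.
- apply: contra k0 => /eqP /(congr1 (@qre R)); rewrite mkquatK_re => ->.
  by rewrite /qre !mxE.
- by rewrite study_form_mkquat; vec_field.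
move=> X; rewrite /qnorm.
rewrite (eq_bigr (fun j => mkquat k C 0 j * mkquat k C 0 j)) //.
rewrite sum_quat /qmul /qconj !mkquatK_re !mkquatK_im !mkquatZ mkquatN !mkquatD.
congr mkquat; first by vec_field.
rewrite /act scalerDr -expr2 hrot; vec_field.
Qed.

(** The coordinates x of the four points are already independent, and the sum of
    the first and third point is not on the Study quadric. *)
Lemma example_study_generic : study_generic example.
Proof.
have C0 : rC (rotor_of pose0) = vec_of_Q (qv 0 0 0).
  by rewrite /= axial_of_Q; q_eval.
have C1 : rC (rotor_of pose1) = vec_of_Q (qv (-4 # 3) (-4 # 3) 0).
  by rewrite /= axial_of_Q; q_eval.
have C2 : rC (rotor_of pose2) = vec_of_Q (qv (-1) 1 1).
  by rewrite /= axial_of_Q; q_eval.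
have C3 : rC (rotor_of pose3) = vec_of_Q (qv (-4 # 3) (-2 # 3) 0).
  by rewrite /= axial_of_Q; q_eval.
have k0 : rk (rotor_of pose0) = of_Q (4 # 1)%BinQ.
  by rewrite /= trace1_of_Q; q_eval.
have k1 : rk (rotor_of pose1) = of_Q (4 # 3)%BinQ.
  by rewrite /= trace1_of_Q; q_eval.
have k2 : rk (rotor_of pose2) = of_Q 1%BinQ.
  by rewrite /= trace1_of_Q; q_eval.
have k3 : rk (rotor_of pose3) = of_Q (2 # 3)%BinQ.
  by rewrite /= trace1_of_Q; q_eval.
have kn i : rk (rotor_of (example i)) != 0.
  elim/ord4_cases: i; rewrite /example [nth _ _ _]/= ?k0 ?k1 ?k2 ?k3;
  exact: of_Q_neq0.
exists (fun i => study_point (example i)); split.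
- by move=> i; apply: study_image_point.
- apply/eqP; rewrite -/(row_free _); apply: inj_row_free => w.
  rewrite mulmx_sum_row sum4E !rowK /example [nth _ _ _]/= [nth _ _ 1]/=
    [nth _ _ 2%:R]/= [nth _ _ 3%:R]/=.
  have lD (A B : study_coords R) : lsubmx (A + B) = lsubmx A + lsubmx B.
    exact: raddfD.
  move/(congr1 lsubmx); rewrite !lD !lsubmx_study_point !mkquatD raddf0.
  rewrite k0 k1 k2 k3 C0 C1 C2 C3 => hw.
  have := congr1 (@qre R) hw; have := congr1 (@qim R) hw.
  rewrite mkquatK_re mkquatK_im {hw}.
  have -> : qre (0 : quat R) = 0 by rewrite /qre !mxE.
  have -> : qim (0 : quat R) = 0 by rewrite /qim !raddf0.
  move=> hC hk.
  have := congr1 (fun u : 'cV[R]_3 => u 0 0) hC.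
  have := congr1 (fun u : 'cV[R]_3 => u 1 0) hC.
  have := congr1 (fun u : 'cV[R]_3 => u 2%:R 0) hC.
  move: hk; rewrite !vecE !vec_of_QE /=; of_Q_numerals.
  move=> hk h2 h1 h0; apply/rowP => j; rewrite mxE.
  by elim/ord4_cases: j; lra.
- exists (delta_mx 0 0 + delta_mx 0 2%:R); rewrite mulmxDl -!rowE !rowK.
  rewrite /example [nth _ _ 0]/= [nth _ _ 2%:R]/= /study_point k0 k2 C0 C2.
  rewrite add_row_mx !mkquatD study_form_mkquat half_of_Q /=; q_eval.
  exact: of_Q_neq0.
Qed.

End StudyImages.

End Example.

(** * The theorem *)

Definition unobstructed_quadrangle (R : realType) (a : quadruple R) : bool :=
  let x := moving_rotor a in
  [&& unobstructed (x 0) (x 1) (x 2%:R) (x 3%:R),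
      unobstructed (x 1) (x 2%:R) (x 3%:R) (x 0),
      unobstructed (x 2%:R) (x 3%:R) (x 0) (x 1) &
      unobstructed (x 3%:R) (x 0) (x 1) (x 2%:R)].

(** The product of all obstructions, over the four cyclic shifts. *)
Lemma unobstructed_polynomial (R : realType) :
  exists f : {mpoly R[4 * (3 * (3 + 1))]},
    forall a : quadruple R,
      (f.@[coordinates a] != 0) = unobstructed_quadrangle a.
Proof.
have P i j k l := poly_obstruction (@poly_moving_rotor R i)
  (@poly_moving_rotor R j) (@poly_moving_rotor R k) (@poly_moving_rotor R l).
have [f hf] := poly_mul (P 0 1 2%:R 3%:R) (poly_mul (P 1 2%:R 3%:R 0)
  (poly_mul (P 2%:R 3%:R 0 1) (P 3%:R 0 1 2%:R))).
have neq4 (p q r s : R) :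
    (p * (q * (r * s)) != 0) = [&& p != 0, q != 0, r != 0 & s != 0].
  by rewrite !mulf_eq0 !negb_or.
by exists f => a; rewrite hf neq4 !prodf_seq_neq0.
Qed.

Lemma same_line_sym (R : realType) (l m : oline R) :
  same_line l m -> same_line m l.
Proof. by move=> h X; split=> /h. Qed.

Lemma same_line_transversal (R : realType) (a : quadruple R) (l m : oline R) :
  same_line l m -> transversal a m -> transversal a l.
Proof.
by move=> lm tm i; have [X [mX aX]] := tm i; exists X; split=> //; apply/lm.
Qed.

Lemma same_line_image (R : realType) (a : displacement R) (l m : oline R) :
  same_line l m -> same_line (line_image a l) (line_image a m).
Proof.
have imp (l1 m1 : oline R) : same_line l1 m1 ->
    forall X, on_line (line_image a l1) X -> on_line (line_image a m1) X.
  move=> h X /on_line_image [t ->].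
  have /h[s ->] : on_line l1 (base l1 + t *: dir l1) by exists t.
  exact: act_on_line_image.
by move=> h X; split; apply: imp => //; apply: same_line_sym.
Qed.

Lemma same_line_skew (R : realType) (a : quadruple R) (l m : oline R) :
  same_line l m -> skew_quadrilateral (homologous_images a m) ->
  skew_quadrilateral (homologous_images a l).
Proof.
move=> lm [L [vL nL]]; exists L; split=> // i X; rewrite -vL.
by split=> -[]; rewrite /homologous_images !(same_line_image _ lm) => *.
Qed.

Lemma example_standing (R : realType) :
  standing_assumptions (example R) /\ unobstructed_quadrangle (example R).
Proof.
split; last first.
  rewrite /unobstructed_quadrangle !example_rotorE.
  by have [-> -> -> ->] := example_unobstructed R.
split; [exact: example_rotation_quadrangle | exact: example_study_generic |].
exists (line_u R), (line_v R); split; first exact: example_two_transversals.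
  exact: example_skew_u.
exact: example_skew_v.
Qed.

Theorem theorem7 (R : realType) :
  generically (@standing_assumptions R) (fun a : quadruple R =>
    forall u v : oline R, the_two_transversals a u v ->
      (forall l : oline R, same_line l u \/ same_line l v ->
         skew_quadrilateral (homologous_images a l) /\
         on_hyperboloid_of_revolution (homologous_images a l)) /\
      (forall l : oline R,
         properly_oriented_skew_quadrilateral (homologous_images a l) /\
         on_hyperboloid_of_revolution (homologous_images a l)
         <->
         properly_oriented_skew_quadrilateral (homologous_images a l) /\
         (same_line l u \/ same_line l v))).
Proof.
have [f hf] := unobstructed_polynomial R.
exists f; split.
  by exists (example R); rewrite hf; exact: example_standing.
move=> a [rq _ [u' [v' [[_ _ _ uv'] su' sv']]]]; rewrite hf.
move=> /and4P[h0 h1 h2 h3] u v [tu tv _ uv].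
have skew_transversal l : transversal a l ->
    skew_quadrilateral (homologous_images a l).
  by move=> /uv' [] /same_line_skew; apply.
have tl l : same_line l u \/ same_line l v -> transversal a l.
  by move=> [] /same_line_transversal; apply.
have uv_revolution l : same_line l u \/ same_line l v ->
    skew_quadrilateral (homologous_images a l) /\
    on_hyperboloid_of_revolution (homologous_images a l).
  move=> /tl t; have s := skew_transversal _ t; split=> //.
  exact: transversal_on_hyperboloid.
split=> // l; split=> -[po h]; split=> //.
  by apply: uv; apply: unobstructed_transversal po h.
by have [] := uv_revolution l h.
Qed.
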